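(* Let $K:\mathbb{Z}^2\to(0,\infty)$ satisfy the following assumptions: - $\sup_{k,l\in\mathbb{Z}}K(k,l)\le C_K$ for some $C_K\in(0,\infty)$; - there exists $g:\mathbb{Z}\to(0,\infty)$ with $K(k,l-1)g(k)g(l-1)=K(l,k-1)g(l)g(k-1)$ for all $k,l\in\mathbb{Z}$; - the limits $\Lambda_+:=\lim_{j\to\infty}\frac{K(j,0)}{K(1,j-1)}$ and $\Lambda_-:=\lim_{j\to-\infty}\frac{K(0,j)}{K(j+1,-1)}$ exist in $(0,\infty]$ and $\mathbf{I}_K:=\big((\Lambda_-\kappa)^{-1},\Lambda_+\kappa\big)\neq\emptyset$, where $\kappa:=\sqrt{K(1,-1)/K(0,0)}$; - $\Lambda_+<\infty$ and $\Lambda_-<\infty$. Then for all $\phi\in\mathbf{I}_K$, the equilibrium $f_\phi$ is stable in $\mathscr{P}_{1,1}$, that is, for every $\varepsilon>0$ there exists $\delta>0$ such that for all $f_0\in\mathscr{P}_{1,1}$ satisfying $\|f_0-f_\phi\|_{1,1}<\delta$ we have $\|f(t)-f_\phi\|_{1,1}<\varepsilon$ for all $t\ge0$, where $f$ is the solution of $\dot f(t)=Q(f(t))$, $t>0$, with initial value $f(0)=f_0$.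
   Context: $\ell_{1,1}(\mathbb{Z})$ is the Banach space of $g:\mathbb{Z}\to\mathbb{R}$ with $\|g\|_{1,1}=\sum_{k\in\mathbb{Z}}(1+|k|)|g(k)|<\infty$. $\mathscr{P}_{1,1}=\{f\in\ell_{1,1}(\mathbb{Z}):f(k)\ge0\ \text{for all }k\in\mathbb{Z},\ \sum_{k\in\mathbb{Z}}f(k)=1\}$. The collision operator associated with $K$ is $Q(f)=Q(f,f)$, where for $k\in\mathbb{Z}$ $$Q(f,g)(k)=\sum_{l\in\mathbb{Z}}\Big(K(l,k-1)g(l)f(k-1)-K(k,l-1)f(k)g(l-1)-K(l,k)g(l)f(k)+K(k+1,l-1)f(k+1)g(l-1)\Big).$$ For $f_0\in\mathscr{P}_{1,1}$ the initial value problem has a unique global solution $f\in C^1([0,\infty);\ell_{1,1}(\mathbb{Z}))$, with $f(t)\in\mathscr{P}_{1,1}$ for all $t\ge0$. Define $$\tilde\psi(k)=\begin{cases}\prod_{j=1}^k\frac{K(1,j-1)}{K(j,0)},&k>0,\\ 1,&k=0,\\ \prod_{j=k}^{-1}\frac{K(j+1,-1)}{K(0,j)},&k<0,\end{cases}\qquad\psi(k)=\tilde\psi(k)\kappa^{-|k|},\qquad Z(\phi)=\sum_{l\in\mathbb{Z}}\psi(l)\phi^l,$$ and $f_\phi(k)=\psi(k)\phi^k/Z(\phi)$ for $\phi\in\mathbf{I}_K$, $k\in\mathbb{Z}$. For $\phi\in\mathbf{I}_K$ one has $Z(\phi)<\infty$, $f_\phi\in\mathscr{P}_{1,1}$ and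 $Q(f_\phi)=0$. *)

(* Defs.v *)
From HB Require Import structures.
From mathcomp Require Import all_boot all_order all_algebra.
From mathcomp Require Import all_classical all_reals all_analysis.
Set Implicit Arguments.
Unset Strict Implicit.
Unset Printing Implicit Defensive.
Import Order.TTheory GRing.Theory Num.Theory.
Import numFieldNormedType.Exports.

Local Open Scope classical_set_scope.
Local Open Scope ring_scope.

Section Defs.
Context {R : realType}.
Implicit Types (K : int -> int -> R) (u f g : int -> R).

(* The sum of an absolutely summable two-sided sequence, as the difference of
   the sums of its positive and negative parts (library [esum] is for
   nonnegative families only). For other sequences the value is junk. *)
Definition sumZ u : R :=
  fine (\esum_(k in [set: int]) (EFin \o u)^\+ k
        - \esum_(k in [set: int]) (EFin \o u)^\- k)%E.

(* Extended-valued: equal to +oo exactly when the sequence is not in l_{1,1},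
   so that a bound or a convergence to 0 also expresses membership. *)
Definition norm11 u : \bar R :=
  \esum_(k in [set: int]) ((1 + `|k|%:~R) * `|u k|)%:E.

Definition l11 : set (int -> R) := [set u | (norm11 u < +oo)%E].

Definition P11 : set (int -> R) :=
  [set f | [/\ l11 f, forall k, 0 <= f k & sumZ f = 1]].

Definition collision2 K f g : int -> R := fun k =>
  sumZ (fun l => K l (k - 1) * g l * f (k - 1)
                 - K k (l - 1) * f k * g (l - 1)
                 - K l k * g l * f k
                 + K (k + 1) (l - 1) * f (k + 1) * g (l - 1)).

Definition collision K f : int -> R := collision2 K f f.

(* [f] restricted to [0, +oo[ is in C^1([0, +oo[; l_{1,1}) with derivative
   [df]; at time 0 the derivative and the continuity are one-sided. Values at
   negative times are irrelevant. *)
Definition C1_l11 (f df : R -> int -> R) : Prop :=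
  [/\ forall t : R, 0 <= t -> l11 (f t),
      forall t : R, 0 <= t -> l11 (df t),
      forall t : R, 0 <= t ->
        norm11 ((s - t)^-1 *: (f s - f t) - df t)
          @[s --> within [set s | 0 <= s] t^'] --> 0%E
    & forall t : R, 0 <= t ->
        norm11 (df s - df t)
          @[s --> within [set s | 0 <= s] (nbhs t)] --> 0%E].

Definition is_solution K (f0 : int -> R) (f : R -> int -> R) : Prop :=
  f 0 = f0 /\
  exists df : R -> int -> R,
    C1_l11 f df /\ forall t : R, 0 < t -> df t = collision K (f t).

Definition kappa K : R := Num.sqrt (K 1 (-1) / K 0 0).

(* For k < 0 the product over k <= j' <= -1 is reindexed by j' = - j. *)
Definition psi_tilde K (k : int) : R :=
  if 0 <= k then
    \prod_(1 <= j < `|k|%N.+1) (K 1 (j%:Z - 1) / K j%:Z 0)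
  else
    \prod_(1 <= j < `|k|%N.+1) (K (- j%:Z + 1) (-1) / K 0 (- j%:Z)).

Definition psi K (k : int) : R := psi_tilde K k * kappa K ^ (- `|k|).

Definition partition_fun K (phi : R) : R := sumZ (fun l => psi K l * phi ^ l).

Definition equilibrium K (phi : R) : int -> R :=
  fun k => psi K k * phi ^ k / partition_fun K phi.

(* The inverse is that of extended reals, with +oo^-1 = 0. *)
Definition I_K K (Lm Lp : \bar R) : set R :=
  [set phi | (((Lm * (kappa K)%:E)^-1 < phi%:E) /\
              (phi%:E < Lp * (kappa K)%:E))%E].

End Defs.

(* Main.v *)
(** The entropy of f relative to mu = f_phi is used only through its dual
  (Donsker--Varadhan) form, as the supremum of sum a f - ln (sum mu e^a) over
  bounded a, so no logarithm of the solution is ever differentiated. One step of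
  the Markov chain on pairs that sends (k, l) to (k - 1, l + 1) with probability
  K(k, l) / C is reversible with respect to mu (x) mu by detailed balance;
  starting from f (x) f, its marginals average to f + Q(f) / (2 C). Hence
  f + Q(f) / (2 C) has at most the entropy of f, which along a solution says that
  each linear functional y = sum a f(t) - ln (sum mu e^a) satisfies
  y' <= 2 C (M - y) whenever M bounds the entropy on [0, T], and this forces
  M <= H(f_0). Positivity of solutions follows from the same comparison argument
  applied to the mass of the negative part. Finally, since mu decays exponentially
  but not faster, the entropy at f is at most a multiple of |f - mu|_{1,1}, and
  conversely small entropy forces |f - mu|_{1,1} to be small. *)
Require Import Defs.
From HB Require Import structures.
From mathcomp Require Import all_boot all_order all_algebra.
From mathcomp Require Import all_classical all_reals all_analysis.
From mathcomp Require Import finmap ring lra.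
Set Implicit Arguments.
Unset Strict Implicit.
Unset Printing Implicit Defensive.
Import Order.TTheory GRing.Theory Num.Theory.
Import numFieldNormedType.Exports.

Local Open Scope classical_set_scope.
Local Open Scope ring_scope.

(** * Absolutely summable families *)

Section TotalSum.
Context {R : realType}.

(** The equation is quadratic, so [f] alone does not evolve by a linear Markov chain. On the pair
    law [f z.1 * f z.2] a collision step is linear, and an additive test function a(k) + a(l) has
    the square of the moment of [a] as its exponential moment, so the entropy bound 2 M of the pair
    comes back as M for [f].

    The weight 1 + |k| is what makes entropy and norm comparable. Finite limits Lambda bound mu
    below by exp(- D (1 + |k|)), so ln (f / mu) grows at most like the weight for every f in [P11];
    phi strictly inside [I_K] gives mu exponential moments, so small multiples of the weight can
    serve as test functions. The comparisons read H <= (D + 1) norm and norm <= H / lam + lam * S2.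
    Hence lam of order eps and H of order lam * eps suffice, and delta is of order eps^2 for small
    eps.

    A solution is given only as a C^1 curve in l_{1,1}; nonnegativity and unit mass at later times
    must be derived before the entropy argument can start. *)

Definition tsum {T : choiceType} (u : T -> R) : R :=
  fine (\esum_(k in [set: T]) (EFin \o u)^\+ k
        - \esum_(k in [set: T]) (EFin \o u)^\- k)%E.

Definition abs_summable {T : choiceType} (u : T -> R) : Prop :=
  (\esum_(k in [set: T]) `|u k|%:E < +oo)%E.

Lemma pos_part_sub_neg_part (x : R) : Num.max x 0 - Num.max (- x) 0 = x.
Proof. by case: (leP x 0) => h; case: (leP (- x) 0) => h'; lra. Qed.

Section OneType.
Context {T : choiceType}.
Implicit Types u v p n : T -> R.

Lemma abs_summable_le u v :
  (forall i, `|u i| <= v i) -> abs_summable v -> abs_summable u.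
Proof.
rewrite /abs_summable => uv; apply: le_lt_trans; apply: le_esum => i _.
by rewrite lee_fin (le_trans (uv i))// ler_norm.
Qed.

Lemma abs_summable_norm u : abs_summable u -> abs_summable (fun i => `|u i|).
Proof.
rewrite /abs_summable; apply: le_lt_trans; apply: le_esum => i _.
by rewrite normr_id.
Qed.

Lemma abs_summableD u v : abs_summable u -> abs_summable v ->
  abs_summable (fun i => u i + v i).
Proof.
move=> su sv; apply: (@abs_summable_le _ (fun i => `|u i| + `|v i|)).
  by move=> i; exact: ler_normD.
rewrite /abs_summable [ltLHS](_ : _ = \esum_(i in [set: T]) (`|u i|%:E + `|v i|%:E)%E).
  by rewrite esumD ?lte_add_pinfty// => i _; rewrite lee_fin.
by apply: eq_esum => i _; rewrite ger0_norm ?addr_ge0.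
Qed.

Lemma abs_summableN u : abs_summable u -> abs_summable (fun i => - u i).
Proof.
by move/abs_summable_norm; apply: abs_summable_le => i; rewrite normrN.
Qed.

Lemma abs_summableB u v : abs_summable u -> abs_summable v ->
  abs_summable (fun i => u i - v i).
Proof. by move=> su sv; apply: abs_summableD => //; exact: abs_summableN. Qed.

Lemma esum_ge0_fine p : (forall i, 0 <= p i) -> abs_summable p ->
  (\esum_(i in [set: T]) (p i)%:E = (tsum p)%:E)%E.
Proof.
move=> p0; rewrite /abs_summable /tsum => sp.
have -> : (\esum_(k in [set: T]) (EFin \o p)^\- k = 0)%E.
  by apply: esum1 => i _; rewrite funenegE /=; apply/max_idPr; rewrite lee_fin oppr_le0.
have -> : (\esum_(k in [set: T]) (EFin \o p)^\+ k = \esum_(k in [set: T]) (p k)%:E)%E.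
  by apply: eq_esum => i _; rewrite funeposE /=; apply/max_idPl; rewrite lee_fin.
have e : (\esum_(k in [set: T]) `|p k|%:E = \esum_(k in [set: T]) (p k)%:E)%E.
  by apply: eq_esum => i _; rewrite ger0_norm.
rewrite sube0 fineK// ge0_fin_numE -?e//.
by apply: esum_ge0 => i _; rewrite lee_fin.
Qed.

Lemma ge0_tsumD p n : (forall i, 0 <= p i) -> (forall i, 0 <= n i) ->
  abs_summable p -> abs_summable n ->
  tsum (fun i => p i + n i) = tsum p + tsum n.
Proof.
move=> p0 n0 sp sn; apply: EFin_inj; rewrite EFinD -!esum_ge0_fine//.
- rewrite -(@esumD _ _ _ (fun i => (p i)%:E) (fun i => (n i)%:E))// => i _;
  by rewrite lee_fin.
- by move=> i; rewrite addr_ge0.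
- exact: abs_summableD.
Qed.

(* Every algebraic property of [tsum] reduces to additivity of [esum] on
   nonnegative families through this characterisation. *)
Lemma tsum_diff u p n : (forall i, 0 <= p i) -> (forall i, 0 <= n i) ->
  abs_summable p -> abs_summable n -> (forall i, u i = p i - n i) ->
  tsum u = tsum p - tsum n.
Proof.
move=> p0 n0 sp sn upn.
pose up (i : T) : R := Num.max (u i) 0; pose un (i : T) : R := Num.max (- u i) 0.
have up0 i : 0 <= up i by rewrite le_max lexx orbT.
have un0 i : 0 <= un i by rewrite le_max lexx orbT.
have upp i : up i <= p i by rewrite ge_max p0 upn lerBlDr lerDl n0.
have unn i : un i <= n i by rewrite ge_max n0 upn opprB lerBlDr lerDl p0.
have sup : abs_summable up by apply: abs_summable_le sp => i; rewrite ger0_norm.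
have sun : abs_summable un by apply: abs_summable_le sn => i; rewrite ger0_norm.
have -> : tsum u = tsum up - tsum un.
  rewrite {1}/tsum.
  have -> : (\esum_(k in [set: T]) (EFin \o u)^\+ k = (tsum up)%:E)%E.
    rewrite -esum_ge0_fine//; apply: eq_esum => i _.
    by rewrite funeposE /= /up EFin_max.
  have -> : (\esum_(k in [set: T]) (EFin \o u)^\- k = (tsum un)%:E)%E.
    rewrite -esum_ge0_fine//; apply: eq_esum => i _.
    by rewrite funenegE /= /un EFin_max.
  by [].
(* Moving the subtracted sums across, it remains to compare [p + un] with [up + n]: nonnegative
   families that agree pointwise. *)
apply/eqP; rewrite subr_eq addrAC eq_sym subr_eq -!ge0_tsumD//; apply/eqP.
congr tsum; apply/funext => i.
move: (upn i) (pos_part_sub_neg_part (u i)); rewrite /up /un; lra.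
Qed.

Lemma tsumE u : abs_summable u -> tsum u =
  tsum (fun i => Num.max (u i) 0) - tsum (fun i => Num.max (- u i) 0).
Proof.
move=> su; have sn := abs_summable_norm su.
have h1 i : `|Num.max (u i) 0| <= `|u i|.
  by rewrite ger0_norm ?le_max ?lexx ?orbT// ge_max ler_norm normr_ge0.
have h2 i : `|Num.max (- u i) 0| <= `|u i|.
  by rewrite ger0_norm ?le_max ?lexx ?orbT// ge_max -normrN ler_norm normr_ge0.
apply: tsum_diff.
- by move=> i; rewrite le_max lexx orbT.
- by move=> i; rewrite le_max lexx orbT.
- exact: abs_summable_le h1 sn.
- exact: abs_summable_le h2 sn.
- by move=> i; rewrite pos_part_sub_neg_part.
Qed.

Lemma tsum_ge0 u : (forall i, 0 <= u i) -> abs_summable u -> 0 <= tsum u.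
Proof.
move=> u0 su; rewrite -lee_fin -esum_ge0_fine//.
by apply: esum_ge0 => i _; rewrite lee_fin.
Qed.

Lemma abs_summable_pos u : abs_summable u ->
  abs_summable (fun i => Num.max (u i) 0).
Proof.
move/abs_summable_norm; apply: abs_summable_le => i.
by rewrite ger0_norm ?le_max ?lexx ?orbT// ge_max ler_norm normr_ge0.
Qed.

Lemma abs_summable_neg u : abs_summable u ->
  abs_summable (fun i => Num.max (- u i) 0).
Proof. by move=> /abs_summableN /abs_summable_pos. Qed.

Lemma tsumD u v : abs_summable u -> abs_summable v ->
  tsum (fun i => u i + v i) = tsum u + tsum v.
Proof.
move=> su sv.
pose up (i : T) : R := Num.max (u i) 0; pose un (i : T) : R := Num.max (- u i) 0.
pose vp (i : T) : R := Num.max (v i) 0; pose vn (i : T) : R := Num.max (- v i) 0.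
have m0 (x : R) : 0 <= Num.max x 0 by rewrite le_max lexx orbT.
have [s1 s2] : abs_summable up /\ abs_summable un.
  by split; [exact: abs_summable_pos|exact: abs_summable_neg].
have [s3 s4] : abs_summable vp /\ abs_summable vn.
  by split; [exact: abs_summable_pos|exact: abs_summable_neg].
rewrite (@tsum_diff _ (fun i => up i + vp i) (fun i => un i + vn i)).
- rewrite (ge0_tsumD (fun i => m0 (u i)) (fun i => m0 (v i)) s1 s3).
  rewrite (ge0_tsumD (fun i => m0 (- u i)) (fun i => m0 (- v i)) s2 s4).
  by rewrite (tsumE su) (tsumE sv) -/up -/un -/vp -/vn; lra.
- by move=> i; rewrite addr_ge0 ?m0.
- by move=> i; rewrite addr_ge0 ?m0.
- exact: abs_summableD.
- exact: abs_summableD.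
- move=> i; rewrite /up /un /vp /vn.
  by move: (pos_part_sub_neg_part (u i)) (pos_part_sub_neg_part (v i)); lra.
Qed.

Lemma tsumN u : abs_summable u -> tsum (fun i => - u i) = - tsum u.
Proof.
move=> su; rewrite (tsumE su) (tsumE (abs_summableN su)) opprB.
by congr (_ - _); congr tsum; apply/funext => i; rewrite opprK.
Qed.

Lemma tsumB u v : abs_summable u -> abs_summable v ->
  tsum (fun i => u i - v i) = tsum u - tsum v.
Proof.
by move=> su sv; rewrite (tsumD su (abs_summableN sv)) (tsumN sv).
Qed.

Lemma ler_tsum u v : abs_summable u -> abs_summable v ->
  (forall i, u i <= v i) -> tsum u <= tsum v.
Proof.
move=> su sv uv; rewrite -subr_ge0 -(tsumB sv su); apply: tsum_ge0.
  by move=> i; rewrite subr_ge0.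
exact: abs_summableB.
Qed.

Lemma ler_norm_tsum u v : abs_summable v -> (forall i, `|u i| <= v i) ->
  `|tsum u| <= tsum v.
Proof.
move=> sv uv; have su := abs_summable_le uv sv.
rewrite ler_norml -(tsumN sv); apply/andP; split; apply: ler_tsum => //.
- exact: abs_summableN.
- by move=> i; move: (uv i); rewrite ler_norml => /andP[].
- by move=> i; move: (uv i); rewrite ler_norml => /andP[].
Qed.

Lemma ge0_esumZl (c : R) (a : T -> \bar R) : 0 < c -> (forall i, 0 <= a i)%E ->
  (\esum_(i in [set: T]) (c%:E * a i) = c%:E * \esum_(i in [set: T]) a i)%E.
Proof.
move=> c0 a0.
have half (d : R) (b : T -> \bar R) : 0 < d -> (forall i, 0 <= b i)%E ->
   (\esum_(i in [set: T]) (d%:E * b i) <= d%:E * \esum_(i in [set: T]) b i)%E.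
  move=> d0 b0; apply: ge_ereal_sup => _ [X [finX XT] <-].
  rewrite -(ge0_mule_fsumr d%:E X b0); apply: lee_wpmul2l; first by rewrite lee_fin ltW.
  by apply: ereal_sup_ubound; exists X.
apply/eqP; rewrite eq_le half//=.
(* The reverse inequality is [half] for the factor [c^-1] and the family [c * a]. *)
rewrite -lee_pdivlMl//; apply: le_trans (half _ _ _ _).
- by apply: le_esum => i _; rewrite muleA -EFinM mulVf ?mul1e ?gt_eqF.
- by rewrite invr_gt0.
- by move=> i; rewrite mule_ge0// lee_fin ltW.
Qed.

Lemma abs_summableZ c u : abs_summable u -> abs_summable (fun i => c * u i).
Proof.
have [->|c0] := eqVneq c 0.
  by move=> _; rewrite /abs_summable esum1// => i _; rewrite mul0r normr0.
move=> su; rewrite /abs_summable.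
rewrite [ltLHS](_ : _ = \esum_(i in [set: T]) (`|c|%:E * `|u i|%:E)%E).
  by rewrite ge0_esumZl ?normr_gt0// lte_mul_pinfty ?lee_fin.
by apply: eq_esum => i _; rewrite normrM.
Qed.

Lemma tsum0 : tsum (fun _ : T => 0 : R) = 0.
Proof.
apply: EFin_inj; rewrite -esum_ge0_fine//; first by rewrite esum1.
by rewrite /abs_summable esum1// => i _; rewrite normr0.
Qed.

Lemma tsumZ c u : abs_summable u -> tsum (fun i => c * u i) = c * tsum u.
Proof.
have pos (d : R) v : 0 < d -> abs_summable v -> (forall i, 0 <= v i) ->
    tsum (fun i => d * v i) = d * tsum v.
  move=> d0 sv v0; apply: EFin_inj; rewrite EFinM -!esum_ge0_fine//.
  - by rewrite -ge0_esumZl.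
  - by move=> i; rewrite mulr_ge0// ltW.
  - exact: abs_summableZ.
have m0 (x : R) : 0 <= Num.max x 0 by rewrite le_max lexx orbT.
have gt0 (d : R) v : 0 < d -> abs_summable v ->
    tsum (fun i => d * v i) = d * tsum v.
  move=> d0 sv; rewrite (tsumE sv) mulrBr.
  have sp := abs_summable_pos sv; have sn := abs_summable_neg sv.
  rewrite -!pos// -(tsumB (abs_summableZ d sp) (abs_summableZ d sn)).
  congr tsum; apply/funext => i; rewrite -mulrBr.
  by rewrite pos_part_sub_neg_part.
move=> su; have [c0|c0|<-] := ltgtP 0 c.
- exact: gt0.
- rewrite -[c in LHS]opprK; under [X in tsum X]funext => i do rewrite mulNr.
  rewrite tsumN ?gt0 ?oppr_gt0//; last exact: abs_summableZ.
  by rewrite mulNr opprK.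
- by rewrite mul0r -[RHS]tsum0; congr tsum; apply/funext => i; rewrite mul0r.
Qed.

Lemma tsumMr c u : abs_summable u -> tsum (fun i => u i * c) = tsum u * c.
Proof.
move=> su; rewrite mulrC -tsumZ//; congr tsum; apply/funext => i; exact: mulrC.
Qed.

Lemma ler_term_tsum u j : (forall i, 0 <= u i) -> abs_summable u ->
  u j <= tsum u.
Proof.
move=> u0 su; rewrite -lee_fin -esum_ge0_fine//.
rewrite (le_trans _ (@esum_ge _ _ _ _ (u j)%:E _))//.
by exists [set j]; [split|rewrite fsbig_set1].
Qed.

Lemma abs_summable_bounded (B : R) (a : T -> R) u :
  (forall i, `|a i| <= B) -> abs_summable u -> abs_summable (fun i => a i * u i).
Proof.
move=> aB su; apply: abs_summable_le (abs_summableZ B (abs_summable_norm su)) => i.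
by rewrite normrM ler_wpM2r.
Qed.

End OneType.

(** * Reindexing and sums over pairs *)

Section TwoTypes.
Context {T U : choiceType}.

Lemma abs_summable_reindex (e : T -> U) (u : U -> R) : bijective e ->
  abs_summable u -> abs_summable (u \o e).
Proof.
move=> be; rewrite /abs_summable (@reindex_esum _ _ _ [set: T] _ e)//.
by rewrite setTT_bijective.
Qed.

Lemma tsum_reindex (e : T -> U) (u : U -> R) : bijective e ->
  tsum (u \o e) = tsum u.
Proof.
move=> be; have se : set_bij [set: T] [set: U] e by rewrite setTT_bijective.
rewrite /tsum (reindex_esum _ _ _ (EFin \o u)^\+%E se).
rewrite (reindex_esum _ _ _ (EFin \o u)^\-%E se); congr (fine (_ - _)%E).
  by apply: eq_esum => i _; rewrite !funeposE.
by apply: eq_esum => i _; rewrite !funenegE.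
Qed.

Lemma esum_pair (a : T -> U -> \bar R) : (forall i j, 0 <= a i j)%E ->
  (\esum_(i in [set: T]) \esum_(j in [set: U]) a i j =
   \esum_(z in [set: T * U]) a z.1 z.2)%E.
Proof.
move=> a0; rewrite esum_esum//; congr (esum _ _).
by apply/seteqP; split.
Qed.

Lemma abs_summable_prod (u : T -> R) (v : U -> R) :
  abs_summable u -> abs_summable v ->
  abs_summable (fun z : T * U => u z.1 * v z.2).
Proof.
move=> su sv; rewrite /abs_summable.
rewrite -(@esum_pair (fun i j => `|u i * v j|%:E))//.
rewrite [ltLHS](_ : _ = \esum_(i in [set: T])
    (`|(tsum (fun j => `|v j|)) * u i|)%:E)%E.
  by apply: abs_summableZ.
apply: eq_esum => i _.
rewrite (@esum_ge0_fine _ (fun j => `|u i * v j|))//; last first.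
  by apply: abs_summable_norm; exact: abs_summableZ.
under [X in tsum X]funext do rewrite normrM.
rewrite tsumZ; last exact: abs_summable_norm.
rewrite normrM mulrC (ger0_norm (tsum_ge0 _ _))//; exact: abs_summable_norm.
Qed.

Lemma abs_summable_section (u : T * U -> R) i :
  abs_summable u -> abs_summable (fun j => u (i, j)).
Proof.
rewrite /abs_summable => su; apply: le_lt_trans su.
pose a (x : T) (y : U) := `|u (x, y)|%:E.
have -> : (\esum_(z in [set: T * U]) `|u z|%:E =
           \esum_(z in [set: T * U]) a z.1 z.2)%E by apply: eq_esum => -[].
rewrite -esum_pair; last by move=> x y; rewrite lee_fin.
apply: esum_ge.
by exists [set i]; [split|rewrite fsbig_set1].
Qed.

Let ge0_tsum_pair (u : T * U -> R) : (forall z, 0 <= u z) -> abs_summable u ->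
  abs_summable (fun i => tsum (fun j => u (i, j))) /\
  tsum u = tsum (fun i => tsum (fun j => u (i, j))).
Proof.
move=> u0 su; have ss i := abs_summable_section i su.
have t0 i : 0 <= tsum (fun j => u (i, j)) by exact: tsum_ge0.
have e : (\esum_(i in [set: T]) (tsum (fun j => u (i, j)))%:E = (tsum u)%:E)%E.
  rewrite -(esum_ge0_fine u0 su).
  pose a (x : T) (y : U) := (u (x, y))%:E.
  have -> : (\esum_(z in [set: T * U]) (u z)%:E =
             \esum_(z in [set: T * U]) a z.1 z.2)%E by apply: eq_esum => -[].
  rewrite -esum_pair; last by move=> i j; rewrite lee_fin.
  by apply: eq_esum => i _; rewrite esum_ge0_fine.
have st : abs_summable (fun i => tsum (fun j => u (i, j))).
  rewrite /abs_summable (_ : esum _ _ = (tsum u)%:E) ?ltry// -e.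
  by apply: eq_esum => i _; rewrite ger0_norm.
by split => //; apply: EFin_inj; rewrite -e esum_ge0_fine.
Qed.

(** Fubini, from Tonelli applied to the positive and the negative part. Summability of the inner
    sums is part of the conclusion because the outer [tsum] is junk without it. *)
Lemma tsum_pair (u : T * U -> R) : abs_summable u ->
  abs_summable (fun i => tsum (fun j => u (i, j))) /\
  tsum u = tsum (fun i => tsum (fun j => u (i, j))).
Proof.
move=> su; have m0 (x : R) : 0 <= Num.max x 0 by rewrite le_max lexx orbT.
have sp := abs_summable_pos su; have sn := abs_summable_neg su.
have [sp1 ep] := ge0_tsum_pair (fun z => m0 (u z)) sp.
have [sn1 en] := ge0_tsum_pair (fun z => m0 (- u z)) sn.
have E : (fun i => tsum (fun j => u (i, j))) =
   (fun i => tsum (fun j => Num.max (u (i, j)) 0)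
             - tsum (fun j => Num.max (- u (i, j)) 0)).
  by apply/funext => i; rewrite -tsumE//; exact: abs_summable_section.
rewrite E; split; first exact: abs_summableB.
by rewrite (tsumE su) ep en (tsumB sp1 sn1).
Qed.

Lemma tsum_prod (u : T -> R) (v : U -> R) : abs_summable u -> abs_summable v ->
  tsum (fun z : T * U => u z.1 * v z.2) = tsum u * tsum v.
Proof.
move=> su sv; have [_ ->] := tsum_pair (abs_summable_prod su sv).
by rewrite -(tsumMr _ su); congr tsum; apply/funext => i /=; rewrite tsumZ.
Qed.

End TwoTypes.
End TotalSum.

(** * Weighted norm and weak form of the collision operator *)

Section WeightedNorm.
Context {R : realType}.
Implicit Types (u v a : int -> R).

Definition weight (k : int) : R := 1 + `|k|%:~R.

Lemma weight_ge1 k : 1 <= weight k.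
Proof. by rewrite lerDl ler0z. Qed.

Lemma weight_gt0 k : 0 < weight k.
Proof. exact: lt_le_trans ltr01 (weight_ge1 k). Qed.

Definition rnorm11 u : R := tsum (fun k => weight k * `|u k|).

Lemma l11_weighted u : l11 u <-> abs_summable (fun k => weight k * `|u k|).
Proof.
rewrite /l11 /abs_summable /norm11 /=.
suff -> : (\esum_(k in [set: int]) ((1 + `|k|%:~R) * `|u k|)%:E =
           \esum_(k in [set: int]) `|weight k * `|u k| |%:E)%E by [].
apply: eq_esum => k _; rewrite [in RHS]ger0_norm// mulr_ge0//.
exact: ltW (weight_gt0 k).
Qed.

Lemma norm11_fine u : l11 u -> norm11 u = (rnorm11 u)%:E.
Proof.
move=> /l11_weighted su; rewrite /rnorm11 -esum_ge0_fine// => k.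
by rewrite mulr_ge0// ltW ?weight_gt0.
Qed.

Lemma rnorm11_ge0 u : l11 u -> 0 <= rnorm11 u.
Proof.
move=> /l11_weighted su; apply: tsum_ge0 => // k.
by rewrite mulr_ge0// ltW ?weight_gt0.
Qed.

Lemma l11_summable u : l11 u -> abs_summable u.
Proof.
move=> /l11_weighted; apply: abs_summable_le => k.
by rewrite ler_peMl ?weight_ge1.
Qed.

Lemma l11D u v : l11 u -> l11 v -> l11 (u + v).
Proof.
move=> /l11_weighted su /l11_weighted sv; apply/l11_weighted.
apply: abs_summable_le (abs_summableD su sv) => k.
rewrite ger0_norm; last by rewrite mulr_ge0// ltW ?weight_gt0.
by rewrite -mulrDr ler_wpM2l ?ler_normD// ltW ?weight_gt0.
Qed.

Lemma l11Z (c : R) u : l11 u -> l11 (c *: u).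
Proof.
move=> /l11_weighted su; apply/l11_weighted.
apply: abs_summable_le (abs_summableZ `|c| su) => k.
rewrite ger0_norm; last by rewrite mulr_ge0// ltW ?weight_gt0.
by rewrite normrM mulrCA.
Qed.

Lemma l11B u v : l11 u -> l11 v -> l11 (u - v).
Proof. by move=> su sv; rewrite -scaleN1r; apply: l11D => //; exact: l11Z. Qed.

Lemma rnorm11D u v : l11 u -> l11 v -> rnorm11 (u + v) <= rnorm11 u + rnorm11 v.
Proof.
move=> su sv; have /l11_weighted sD := l11D su sv.
move: su sv => /l11_weighted su /l11_weighted sv.
rewrite /rnorm11 -tsumD//; apply: ler_tsum => //; first exact: abs_summableD.
by move=> k; rewrite -mulrDr ler_wpM2l ?ler_normD// ltW ?weight_gt0.
Qed.

Lemma rnorm11Z c u : l11 u -> rnorm11 (c *: u) = `|c| * rnorm11 u.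
Proof.
move=> /l11_weighted su; rewrite /rnorm11 -tsumZ//; congr tsum.
by apply/funext => k; rewrite normrM mulrCA.
Qed.

Lemma rnorm11_lip u v : l11 u -> l11 v ->
  `|rnorm11 u - rnorm11 v| <= rnorm11 (u - v).
Proof.
move=> su sv; rewrite ler_norml lerBrDr lerBlDr.
have h1 := rnorm11D (l11B su sv) sv; rewrite subrK in h1.
have h2 := rnorm11D (l11B sv su) su; rewrite subrK in h2.
have e : rnorm11 (v - u) = rnorm11 (u - v).
  by rewrite -opprB -scaleN1r rnorm11Z ?normrN1 ?mul1r//; exact: l11B.
by rewrite h1 andbT; move: h2; rewrite e; lra.
Qed.

Lemma tsum_bounded_rnorm11 (B : R) a u : (forall k, `|a k| <= B) -> l11 u ->
  `|tsum (fun k => a k * u k)| <= B * rnorm11 u.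
Proof.
move=> aB /[dup] lu /l11_weighted su; rewrite /rnorm11 -tsumZ//.
apply: ler_norm_tsum; first exact: abs_summableZ.
move=> k; rewrite normrM ler_pM// ler_peMl ?weight_ge1//.
Qed.

End WeightedNorm.

Section WeakForm.
Context {R : realType}.
Implicit Types (K : int -> int -> R) (f a : int -> R).

Definition interaction K f (z : int * int) : R := K z.1 z.2 * f z.1 * f z.2.

Lemma interaction_summable K C f : (forall k l, `|K k l| <= C) ->
  abs_summable f -> abs_summable (interaction K f).
Proof.
move=> KC sf; have sff := abs_summable_prod sf sf.
rewrite /interaction; under [X in abs_summable X]funext do rewrite -mulrA.
exact: abs_summable_bounded sff.
Qed.

(** Each of the four terms of Q is [interaction K f] composed with a bijection of the pairs ([e1] to
    [e4]); undoing it moves the shift onto [a]. What remains is the increment of a(z.1) + a(z.2)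
    under the jump to z.1 - 1, z.2 + 1. Boundedness of [K] and [a] makes the four double series
    converge absolutely, so that they can be rearranged separately. *)
Lemma collision_weak_form K C f a (B : R) :
  (forall k l, `|K k l| <= C) -> abs_summable f -> (forall k, `|a k| <= B) ->
  tsum (fun k => a k * collision K f k) =
  tsum (fun z => interaction K f z *
     (a (z.2 + 1) - a z.1 - a z.2 + a (z.1 - 1))).
Proof.
move=> KC sf aB.
have sF := interaction_summable KC sf.
have sH (e : int * int -> int) : abs_summable (fun z => a (e z) * interaction K f z).
  by apply: abs_summable_bounded sF => z; exact: aB.
pose e1 (z : int * int) : int * int := (z.2, z.1 - 1).
pose e2 (z : int * int) : int * int := (z.1, z.2 - 1).
pose e3 (z : int * int) : int * int := (z.2, z.1).
pose e4 (z : int * int) : int * int := (z.1 + 1, z.2 - 1).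
have b1 : bijective e1.
  by exists (fun z => (z.2 + 1, z.1)) => -[k l]; rewrite /e1/= ?addrK ?subrK.
have b2 : bijective e2.
  by exists (fun z => (z.1, z.2 + 1)) => -[k l]; rewrite /e2/= ?addrK ?subrK.
have b3 : bijective e3 by exists (fun z => (z.2, z.1)) => -[k l].
have b4 : bijective e4.
  by exists (fun z => (z.1 - 1, z.2 + 1)) => -[k l]; rewrite /e4/= ?addrK ?subrK.
pose H1 z := a (z.2 + 1) * interaction K f z.
pose H2 z := a z.1 * interaction K f z.
pose H3 z := a z.2 * interaction K f z.
pose H4 z := a (z.1 - 1) * interaction K f z.
have [s1 s2 s3 s4] : [/\ abs_summable H1, abs_summable H2, abs_summable H3 & abs_summable H4].
  by split; exact: sH.
have [r1 r2 r3 r4] : [/\ abs_summable (H1 \o e1), abs_summable (H2 \o e2),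
    abs_summable (H3 \o e3) & abs_summable (H4 \o e4)].
  by split; exact: abs_summable_reindex.
pose G z := (H1 \o e1) z - (H2 \o e2) z - (H3 \o e3) z + (H4 \o e4) z.
have s12 := abs_summableB r1 r2; have s123 := abs_summableB s12 r3.
have sG : abs_summable G by exact: abs_summableD.
have [_ GE] := tsum_pair sG.
pose D z := (interaction K f \o e1) z - (interaction K f \o e2) z
            - (interaction K f \o e3) z + (interaction K f \o e4) z.
have sD : abs_summable D.
  by apply: abs_summableD; [apply: abs_summableB; [apply: abs_summableB|]|];
    exact: abs_summable_reindex.
have E : (fun k => a k * collision K f k) = (fun k => tsum (fun l => G (k, l))).
  apply/funext => k.
  (* [sumZ] and [tsum] at [int] have the same body, so this is a conversion. *)
  rewrite -[collision K f k]/(tsum (fun l => D (k, l))) -tsumZ.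
    congr tsum; apply/funext => l.
    by rewrite /G /H1 /H2 /H3 /H4 /D /= subrK addrK; ring.
  exact: abs_summable_section.
rewrite E -GE.
rewrite /G (tsumD s123 r4) (tsumB s12 r3) (tsumB r1 r2).
rewrite !tsum_reindex// -(tsumB s1 s2) -tsumB//; last exact: abs_summableB.
rewrite -tsumD//; last by apply: abs_summableB => //; exact: abs_summableB.
by congr tsum; apply/funext => z; rewrite /H1 /H2 /H3 /H4; ring.
Qed.

End WeakForm.

(** * Comparison principle along trajectories *)

Section Gronwall.
Context {R : realType}.

(** Integrating factor: [w] below is nonincreasing, since c * expR (l * t) solves the equality case.
    The exponent [l] is left free because the forcing is constant for the entropy (l = 0) but grows
    exponentially for the negative mass. *)
Lemma gronwall (y : R -> R) (T b B l : R) : 0 < l + B ->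
  {within `[0, T], continuous y} ->
  (forall t, t \in `]0, T[ -> derivable y t 1) ->
  (forall t, t \in `]0, T[ -> 'D_1 y t <= b * expR (l * t) - B * y t) ->
  forall t, t \in `[0, T] ->
    y t <= expR (- B * t) * (y 0 - b / (l + B)) + b / (l + B) * expR (l * t).
Proof.
move=> lB0 cy dy yle t t0T.
set c := b / (l + B).
pose w s := expR (B * s) * y s - c * expR ((l + B) * s).
have dexp (k s : R) : is_derive s 1 (fun x => expR (k * x)) (k * expR (k * s)).
  by apply: is_derive_eq; rewrite ?scaler1 /GRing.scale /=; ring.
have dw s : s \in `]0, T[ -> is_derive s 1 w
    (expR (B * s) * ('D_1 y s + B * y s) - c * (l + B) * expR ((l + B) * s)).
  move=> sT; have := dy _ sT => /derivableP dys.
  have d2 := @is_deriveM _ _ _ _ _ _ _ _ (dexp B s) dys.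
  have d3 := @is_deriveZ _ _ _ _ c _ _ _ (dexp (l + B) s).
  have d4 := @is_deriveB _ _ _ _ _ _ _ _ _ d2 d3.
  by apply: (is_derive_eq d4); rewrite /GRing.scale /=; ring.
have t00 : 0 \in `[0, T].
  by move: t0T; rewrite !in_itv/= lexx => /andP[]; exact: le_trans.
have t0 : 0 <= t by move: t0T; rewrite in_itv/= => /andP[].
have : w t <= w 0.
  apply: (@ler0_derive1_le_cc _ w 0 T _ _ _ t 0 t0T t00 t0).
  - by move=> s sT; have [] := dw _ sT.
  - move=> s sT; rewrite derive1E; have [_ ->] := dw _ sT.
    rewrite subr_le0 mulrDl expRD /c divfK ?gt_eqF// (mulrC (expR (l * s))).
    rewrite mulrCA ler_wpM2l ?expR_ge0//.
    by have := yle _ sT; lra.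
  - have cexp (k : R) : continuous (fun x : R => expR (k * x)).
      move=> x; apply: differentiable_continuous; apply/derivable1_diffP.
      by have [] := dexp k x.
    move=> x; apply: cvgB; last first.
      by apply: cvgM; [exact: cvg_cst|exact: continuous_subspaceT].
    by apply: cvgM; [exact: continuous_subspaceT|exact: cy].
rewrite /w !mulr0 expR0 !mulr1 mul1r => wle.
rewrite -(ler_pM2l (expR_gt0 (B * t))) mulrDr mulrA -expRD mulNr subrr expR0 mul1r.
rewrite mulrCA -expRD -mulrDl (addrC B l); move: wle; lra.
Qed.

End Gronwall.

(** * Differentiable curves in l_{1,1} and bounded linear functionals along them *)

Section Trajectories.
Context {R : realType}.
Implicit Types (a : int -> R) (f df : R -> int -> R).

Lemma near_rnorm11 (S : Type) (F : set_system S) (FF : Filter F)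
    (g : S -> int -> R) :
  norm11 (g s) @[s --> F] --> 0%E ->
  forall eps : R, 0 < eps -> \forall s \near F, l11 (g s) /\ rnorm11 (g s) < eps.
Proof.
move=> /fine_cvgP[gfin /cvgrPdist_lt gcvg] eps eps0.
near=> s.
have lg : l11 (g s).
  rewrite /l11/=; have : norm11 (g s) \is a fin_num by near: s.
  by rewrite fin_numE => /andP[_]; rewrite lt_neqAle leey => ->.
split=> //; have : `|0 - fine (norm11 (g s))| < eps by near: s; exact: gcvg.
by rewrite norm11_fine//= sub0r normrN; apply: le_lt_trans; exact: ler_norm.
Unshelve. all: by end_near. Qed.

Variables (f df : R -> int -> R).
Hypothesis fC1 : C1_l11 f df.

Let fl t : 0 <= t -> l11 (f t). Proof. by case: fC1 => H _ _ _; exact: H. Qed.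
Let dfl t : 0 <= t -> l11 (df t). Proof. by case: fC1 => _ H _ _; exact: H. Qed.

(** Continuity of [f] is not stated in [C1_l11]. Near t the difference quotient is within 1 of
    [df t], so the increment of [f] has norm at most |s - t| (1 + norm of [df t]). *)
Lemma C1_l11_continuous (t : R) : 0 <= t -> forall eps : R, 0 < eps ->
  \forall s \near within [set s | 0 <= s] (nbhs t), rnorm11 (f s - f t) < eps.
Proof.
move=> t0 eps eps0; case: fC1 => _ _ /(_ _ t0) H _.
have {}H := near_rnorm11 _ H ltr01.
have N0 : 0 < 1 + rnorm11 (df t).
  by rewrite ltr_pwDl// rnorm11_ge0//; exact: dfl.
have {}H : \forall s \near nbhs t, s != t -> 0 <= s ->
    l11 ((s - t)^-1 *: (f s - f t) - df t) /\
    rnorm11 ((s - t)^-1 *: (f s - f t) - df t) < 1.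
  exact: H.
rewrite near_withinE; near=> s => /= s0.
have [->|st] := eqVneq s t.
  rewrite subrr /rnorm11; under [X in tsum X]funext do rewrite normr0 mulr0.
  by rewrite tsum0.
have [lg gN] : l11 ((s - t)^-1 *: (f s - f t) - df t) /\
    rnorm11 ((s - t)^-1 *: (f s - f t) - df t) < 1.
  by move: st s0; near: s.
have -> : f s - f t = (s - t) *: (((s - t)^-1 *: (f s - f t) - df t) + df t).
  by rewrite subrK scalerA mulfV ?subr_eq0// scale1r.
rewrite rnorm11Z; last by apply: l11D => //; exact: dfl.
apply: (@le_lt_trans _ _ (`|s - t| * (1 + rnorm11 (df t)))).
  apply: ler_wpM2l => //; apply: (le_trans (rnorm11D lg (dfl t0))).
  by rewrite lerD2r ltW.
rewrite -ltr_pdivlMr// distrC; near: s.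
apply: cvgr_dist_lt; [exact: cvg_id|exact: divr_gt0].
Unshelve. all: by end_near. Qed.

Lemma lipschitz_continuous_along (y : R -> R) (c T : R) : 0 < c ->
  (forall s t : R, 0 <= s -> 0 <= t -> `|y s - y t| <= c * rnorm11 (f s - f t)) ->
  {within `[0, T], continuous y}.
Proof.
move=> c0 yc; apply/subspace_continuousP => t /=; rewrite in_itv/= => /andP[t0 tT].
apply/cvgrPdist_lt => eps eps0.
have := C1_l11_continuous t0 (divr_gt0 eps0 c0); rewrite !near_withinE.
apply: filterS => s H /=; rewrite in_itv/= => /andP[s0 sT].
rewrite distrC; apply: (le_lt_trans (yc _ _ s0 t0)).
by rewrite mulrC -ltr_pdivlMr//; exact: H.
Qed.

Lemma rnorm11_bounded_along (T : R) :
  exists M, 0 < M /\ forall t : R, t \in `[0, T] -> rnorm11 (f t) <= M.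
Proof.
have [T0|T0] := leP 0 T; last first.
  exists 1; split=> // t; rewrite in_itv/= => /andP[t0 tT].
  by have := lt_le_trans T0 (le_trans t0 tT); rewrite ltxx.
have cN : {within `[0, T], continuous (fun t => rnorm11 (f t))}.
  apply: (@lipschitz_continuous_along _ 1) => // s t s0 t0.
  by rewrite mul1r; apply: rnorm11_lip; exact: fl.
have [c cT cM] := EVT_max T0 cN.
exists (1 + rnorm11 (f c)); split.
  by rewrite ltr_pwDl// rnorm11_ge0//; apply: fl; move: cT; rewrite in_itv/= => /andP[].
by move=> t tT; rewrite (le_trans (cM t tT))// lerDr.
Qed.

Section Functional.
Variables (a : int -> R) (B : R).
Hypothesis aB : forall k, `|a k| <= B.

Let tsum_functionalB u v : l11 u -> l11 v ->
  tsum (fun k => a k * u k) - tsum (fun k => a k * v k) =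
  tsum (fun k => a k * (u - v) k).
Proof.
move=> lu lv; rewrite -tsumB.
- by congr tsum; apply/funext => k; rewrite mulrBr.
- by apply: (abs_summable_bounded aB); exact: l11_summable.
- by apply: (abs_summable_bounded aB); exact: l11_summable.
Qed.

Lemma functional_continuous (T : R) :
  {within `[0, T], continuous (fun t => tsum (fun k => a k * f t k))}.
Proof.
(* [1 + B] because the Lipschitz constant must be positive and [B] may be 0. *)
apply: (@lipschitz_continuous_along _ (1 + B)).
  by rewrite ltr_pwDl// (le_trans _ (aB 0)).
move=> s t s0 t0.
have lf := l11B (fl s0) (fl t0).
rewrite tsum_functionalB; [|exact: fl..].
apply: (le_trans (tsum_bounded_rnorm11 aB lf)).
by rewrite ler_wpM2r ?rnorm11_ge0// lerDr.
Qed.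

Lemma functional_derive (t : R) : 0 < t ->
  is_derive t 1 (fun t => tsum (fun k => a k * f t k))
    (tsum (fun k => a k * df t k)).
Proof.
move=> t0; set y := fun t => _; set L := tsum _.
suff H : (fun h => h^-1 *: ((y \o shift t) (h *: 1) - y t)) @ 0^' --> L.
  by split; [exact: cvgP H|exact: cvg_lim H].
have B0 : 0 < 1 + B by rewrite ltr_pwDl// (le_trans _ (aB 0)).
apply/cvgrPdist_lt => eps eps0.
case: fC1 => _ _ /(_ _ (ltW t0)) H _.
have {H} H := near_rnorm11 _ H (divr_gt0 eps0 B0).
have {}H : \forall s \near nbhs t, s != t -> 0 <= s ->
    l11 ((s - t)^-1 *: (f s - f t) - df t) /\
    rnorm11 ((s - t)^-1 *: (f s - f t) - df t) < eps / (1 + B).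
  exact: H.
move: H => /nbhs_ballP[d /= d0 H].
(* A radius at most t keeps h + t in the half-line where [f] is controlled, so the one-sided
   hypothesis yields a two-sided derivative. *)
rewrite near_withinE; apply/nbhs_ballP; exists (Num.min d t).
  by rewrite /= lt_min d0.
move=> h; rewrite /ball/= sub0r normrN lt_min => /andP[hd ht] h0.
have s0 : 0 <= h + t.
  by move: ht; rewrite ltr_norml => /andP[+ _]; rewrite ltrNl; lra.
have st : h + t != t by rewrite -subr_eq0 addrK.
have [] := H (h + t) _ st s0.
  by rewrite /ball/= opprD addrCA subrr addr0 normrN.
rewrite addrK => lg gN.
rewrite /y /= /GRing.scale /= mulr1 tsum_functionalB; [|exact: fl|exact: fl (ltW t0)].
have lf : l11 (f (h + t) - f t) by apply: l11B; apply: fl => //; exact: ltW.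
rewrite -tsumZ; last first.
  by apply: (abs_summable_bounded aB); exact: l11_summable.
rewrite distrC -/L.
have -> : tsum (fun k => h^-1 * (a k * (f (h + t) - f t) k)) - L =
    tsum (fun k => a k * (h^-1 *: (f (h + t) - f t) - df t) k).
  rewrite -tsum_functionalB; last exact: dfl (ltW t0).
    by congr (_ - _); congr tsum; apply/funext => k; rewrite /= mulrCA.
  exact: l11Z.
apply: (le_lt_trans (tsum_bounded_rnorm11 aB lg)).
apply: (@le_lt_trans _ _ ((1 + B) * rnorm11 (h^-1 *: (f (h + t) - f t) - df t))).
  by rewrite ler_wpM2r ?rnorm11_ge0// lerDr.
by rewrite mulrC -ltr_pdivlMr.
Qed.

End Functional.

Lemma functional_gronwall a (B b r l T : R) : (forall k, `|a k| <= B) ->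
  0 < l + r ->
  (forall t : R, t \in `]0, T[ -> tsum (fun k => a k * df t k) <=
     b * expR (l * t) - r * tsum (fun k => a k * f t k)) ->
  forall t : R, t \in `[0, T] -> tsum (fun k => a k * f t k) <=
    expR (- r * t) * (tsum (fun k => a k * f 0 k) - b / (l + r))
    + b / (l + r) * expR (l * t).
Proof.
move=> aB lr H; apply: gronwall => //.
- exact: functional_continuous aB _.
- move=> t; rewrite in_itv/= => /andP[t0 _].
  by have [] := functional_derive aB t0.
- move=> t tT; have /andP[t0 _] : 0 < t < T by move: tT; rewrite in_itv.
  have [_ ->] := functional_derive aB t0; exact: H.
Qed.

End Trajectories.

(** * Positivity *)

Section Positivity.
Context {R : realType}.
Variables (K : int -> int -> R) (C : R).
Hypothesis K_gt0 : forall k l, 0 < K k l.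
Hypothesis K_le : forall k l, K k l <= C.

Let K_norm k l : `|K k l| <= C. Proof. by rewrite gtr0_norm. Qed.

Let C_gt0 : 0 < C. Proof. exact: lt_le_trans (K_gt0 0 0) (K_le 0 0). Qed.

(** The weights a1, a2 belong to the sites that a pair leaves, b1, b2 to those where it arrives. For
    x, y >= 0 the b terms are dropped. In the other sign cases the right side contains a negative
    part with factor at least 2, which covers the bracket, of absolute value at most 2. *)
Lemma interaction_neg_bound (k x y a1 a2 b1 b2 : R) : 0 < k -> k <= C ->
  0 <= a1 <= 1 -> 0 <= a2 <= 1 -> 0 <= b1 <= 1 -> 0 <= b2 <= 1 ->
  k * x * y * (a1 + a2 - b1 - b2) <=
  C * ((a1 * Num.max x 0) * `|y| + `|x| * (a2 * Num.max y 0)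
       + 2 * (`|x| * Num.max (- y) 0 + Num.max (- x) 0 * `|y|)).
Proof.
move=> k0 kC /andP[a10 a11] /andP[a20 a21] /andP[b10 b11] /andP[b20 b21].
have mn (z : R) : (Num.max z 0 = `|z| /\ Num.max (- z) 0 = 0 /\ z = `|z|) \/
   (Num.max z 0 = 0 /\ Num.max (- z) 0 = `|z| /\ z = - `|z|).
  have /orP[z0|z0] := le_total 0 z; [left|right].
    by rewrite (ger0_norm z0) (max_l z0) max_r ?oppr_le0.
  by rewrite (ler0_norm z0) opprK (max_r z0) max_l ?oppr_ge0.
have : k * (`|x| * `|y|) <= C * (`|x| * `|y|) by apply: ler_wpM2r => //; exact: mulr_ge0.
have : 0 <= k * (`|x| * `|y|) by rewrite !mulr_ge0// ltW.
have main (s m n : R) : 0 <= m -> m <= n -> 0 <= s -> m * s <= n * s.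
  by move=> m0 mn' s0; exact: ler_wpM2r.
set m := k * _; set n := C * _ => m0 mn'.
have n0 : 0 <= n := le_trans m0 mn'.
case: (mn x) => -[-> [-> ex]]; case: (mn y) => -[-> [-> ey]].
- rewrite {1}ex {1}ey.
  have -> : k * `|x| * `|y| = m by rewrite /m mulrA.
  have -> : C * (a1 * `|x| * `|y| + `|x| * (a2 * `|y|) + 2 * (`|x| * 0 + 0 * `|y|))
     = n * (a1 + a2) by rewrite /n; ring.
  apply: (le_trans _ (main (a1 + a2) _ _ m0 mn' _)); last by rewrite addr_ge0.
  by apply: ler_wpM2l => //; lra.
- rewrite {1}ex {1}ey.
  have -> : k * `|x| * - `|y| = - m by rewrite /m; ring.
  have -> : C * (a1 * `|x| * `|y| + `|x| * (a2 * 0) + 2 * (`|x| * `|y| + 0 * `|y|))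
     = n * (a1 + 2) by rewrite /n; ring.
  apply: (le_trans _ (main (a1 + 2) _ _ m0 mn' _)); last by rewrite addr_ge0.
  by rewrite mulNr -mulrN; apply: ler_wpM2l => //; lra.
- rewrite {1}ex {1}ey.
  have -> : k * - `|x| * `|y| = - m by rewrite /m; ring.
  have -> : C * (a1 * 0 * `|y| + `|x| * (a2 * `|y|) + 2 * (`|x| * 0 + `|x| * `|y|))
     = n * (a2 + 2) by rewrite /n; ring.
  apply: (le_trans _ (main (a2 + 2) _ _ m0 mn' _)); last by rewrite addr_ge0.
  by rewrite mulNr -mulrN; apply: ler_wpM2l => //; lra.
- rewrite {1}ex {1}ey.
  have -> : k * - `|x| * - `|y| = m by rewrite /m; ring.
  have -> : C * (a1 * 0 * `|y| + `|x| * (a2 * 0) + 2 * (`|x| * `|y| + `|x| * `|y|))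
     = n * 4 by rewrite /n; ring.
  apply: (le_trans _ (main 4 _ _ m0 mn' _)) => //.
  by apply: ler_wpM2l => //; lra.
Qed.

(* The loss term is proportional to [f], so it only counts against the positive
   part, where it is absorbed by the damping [- r * y] of the comparison
   argument; everything else carries a factor of the negative part. *)
Lemma collision_neg_bound (f a : int -> R) (P : R) : abs_summable f ->
  tsum (fun k => `|f k|) <= P -> (forall k, 0 <= a k <= 1) ->
  tsum (fun k => - a k * collision K f k) <=
  6 * C * P * tsum (fun k => Num.max (- f k) 0)
  - 2 * C * P * tsum (fun k => - a k * f k).
Proof.
move=> sf fP a01.
have aB k : `|- a k| <= 1 by rewrite normrN; have /andP[? ?] := a01 k; rewrite ger0_norm.
have aB' k : `|a k| <= 1 by rewrite -normrN.
rewrite (collision_weak_form K_norm sf aB).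
have sn := abs_summable_neg sf; have sa := abs_summable_norm sf.
have sp := abs_summable_bounded aB' (abs_summable_pos sf).
pose v (z : int * int) := C * ((a z.1 * Num.max (f z.1) 0) * `|f z.2|
  + `|f z.1| * (a z.2 * Num.max (f z.2) 0)
  + 2 * (`|f z.1| * Num.max (- f z.2) 0 + Num.max (- f z.1) 0 * `|f z.2|)).
have s1 := abs_summable_prod sp sa; have s2 := abs_summable_prod sa sp.
have s3 := abs_summable_prod sa sn; have s4 := abs_summable_prod sn sa.
have s12 := abs_summableD s1 s2; have s34 := abs_summableD s3 s4.
have s5 := abs_summableZ 2 s34; have s6 := abs_summableD s12 s5.
have sv : abs_summable v by exact: (abs_summableZ C s6).
have vE : tsum v = C * (2 * tsum (fun k => a k * Num.max (f k) 0) * tsum (fun k => `|f k|)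
   + 4 * tsum (fun k => `|f k|) * tsum (fun k => Num.max (- f k) 0)).
  rewrite /v (tsumZ C s6) (tsumD s12 s5) (tsumD s1 s2) (tsumZ 2 s34) (tsumD s3 s4).
  by rewrite (tsum_prod sp sa) (tsum_prod sa sp) (tsum_prod sa sn) (tsum_prod sn sa); ring.
have sF : abs_summable (fun z => interaction K f z *
     (- a (z.2 + 1) - - a z.1 - - a z.2 + - a (z.1 - 1))).
  have := @abs_summable_bounded _ _ 4 (fun z : int * int =>
    - a (z.2 + 1) - - a z.1 - - a z.2 + - a (z.1 - 1)) _ _ (interaction_summable K_norm sf).
  under [X in _ -> abs_summable X]funext do rewrite mulrC.
  apply => z; move: (aB' (z.2 + 1)) (aB' z.1) (aB' z.2) (aB' (z.1 - 1)).
  by rewrite !ler_norml => /andP[? ?] /andP[? ?] /andP[? ?] /andP[? ?]; lra.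
have le1 : tsum (fun z => interaction K f z *
     (- a (z.2 + 1) - - a z.1 - - a z.2 + - a (z.1 - 1))) <= tsum v.
  apply: ler_tsum => // z; rewrite /v.
  apply: le_trans (interaction_neg_bound (f z.1) (f z.2) (K_gt0 z.1 z.2)
    (K_le z.1 z.2) (a01 z.1) (a01 z.2) (a01 (z.2 + 1)) (a01 (z.1 - 1))).
  by rewrite /interaction le_eqVlt; apply/orP; left; apply/eqP; ring.
apply: (le_trans le1); rewrite vE.
set A := tsum (fun k => a k * Num.max (f k) 0); set F := tsum (fun k => `|f k|).
set N := tsum (fun k => Num.max (- f k) 0).
have A0 : 0 <= A.
  by apply: tsum_ge0 => // k; rewrite mulr_ge0 ?le_max ?lexx ?orbT//; have /andP[] := a01 k.
have N0 : 0 <= N by apply: tsum_ge0 => // k; rewrite le_max lexx orbT.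
(* Since a <= 1, the positive part satisfies a f^+ = a f + a f^- <= a f + f^-. This turns [A] into
   the damping term and raises the coefficient of [N] from 4 to 6. *)
have AN : A <= N - tsum (fun k => - a k * f k).
  have sna := abs_summable_bounded aB sf.
  rewrite /N -(tsumB sn sna); apply: ler_tsum => //; first exact: abs_summableB.
  move=> k; have /andP[? ?] := a01 k.
  rewrite -{3}(pos_part_sub_neg_part (f k)) mulNr opprK mulrBr.
  have : 0 <= Num.max (- f k) 0 by rewrite le_max lexx orbT.
  by move=> m0; rewrite addrCA lerDl subr_ge0 ler_piMl.
have F0 : 0 <= F by exact: tsum_ge0.
have P0 : 0 <= P := le_trans F0 fP.
have -> : 6 * C * P * N - 2 * C * P * tsum (fun k => - a k * f k) =
  C * (2 * (N - tsum (fun k => - a k * f k)) * P + 4 * P * N) by ring.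
apply: ler_wpM2l; first exact: ltW.
apply: lerD.
  by apply: ler_pM => //; [exact: mulr_ge0|rewrite ler_wpM2l].
by apply: ler_wpM2r => //; rewrite ler_wpM2l.
Qed.

Variables (f df : R -> int -> R).
Hypothesis fC1 : C1_l11 f df.
Hypothesis dfE : forall t : R, 0 < t -> df t = collision K (f t).

Let f_summable (t : R) : 0 <= t -> abs_summable (f t).
Proof. by case: fC1 => H _ _ _ t0; apply/l11_summable/H. Qed.

Lemma mass_conservation (t : R) : 0 <= t -> tsum (f t) = tsum (f 0).
Proof.
move=> t0.
(* A constant test function has zero increment under every jump, so b = r = 0; the exponent l = 1
   only secures 0 < l + r. Taking c = 1 and c = -1 gives equality. *)
have key (c : R) : tsum (fun k => c * f t k) <= tsum (fun k => c * f 0 k).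
  have := @functional_gronwall _ _ _ fC1 (fun=> c) `|c| 0 0 1 t _ _ _ t.
  rewrite !(oppr0, mul0r, expR0, mul1r, subr0, addr0); apply => //.
  - move=> s; rewrite in_itv/= => /andP[s0 _].
    rewrite !mul0r subr0 dfE//.
    rewrite (collision_weak_form K_norm (f_summable (ltW s0)) (fun=> lexx `|c|)).
    rewrite -[leRHS](@tsum0 _ (int * int)%type) le_eqVlt; apply/orP; left; apply/eqP.
    by congr tsum; apply/funext => z; ring.
  - by rewrite in_itv/= t0 lexx.
apply/eqP; rewrite eq_le.
have := key 1; have := key (-1).
rewrite !tsumZ; [|exact: f_summable..].
by rewrite !mul1r !mulN1r lerN2 => -> ->.
Qed.

(* With M the supremum over [0, t] of e^(- lam s) times the mass of the negative
   part, the comparison principle yields M <= 6 C P M / (lam + 2 C P) = 3/5 M. *)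
Lemma nonneg_preserved (t : R) : (forall k, 0 <= f 0 k) -> 0 <= t ->
  forall k, 0 <= f t k.
Proof.
move=> f00 t0.
have [P [P0 fP]] := rnorm11_bounded_along fC1 t.
have lf (s : R) : 0 <= s -> l11 (f s) by case: fC1 => H _ _ _; exact: H.
have fP1 s : s \in `[0, t] -> tsum (fun k => `|f s k|) <= P.
  move=> /[dup] sT; rewrite in_itv/= => /andP[s0 _]; apply: (le_trans _ (fP _ sT)).
  apply: ler_tsum; first exact/abs_summable_norm/f_summable.
    by apply/l11_weighted; exact: lf.
  by move=> k; rewrite ler_peMl ?weight_ge1.
(* Any rate above 4 C P would make 6 C P / (lam + 2 C P) smaller than 1. *)
pose lam := 8 * C * P.
have lam0 : 0 < lam by rewrite !mulr_gt0.
(* Negative mass is not differentiable in time, but it is the supremum of the differentiable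
   functionals sum - a f with 0 <= a <= 1; the indicator of f <= 0 attains it in [Nle]. *)
pose E := [set x | exists s a, [/\ s \in `[0, t], forall k, 0 <= a k <= 1 &
   x = expR (- (lam * s)) * tsum (fun k => - a k * f s k)]].
have aB (a : int -> R) : (forall k, 0 <= a k <= 1) -> forall k, `|- a k| <= 1.
  by move=> a01 k; rewrite normrN; have /andP[? ?] := a01 k; rewrite ger0_norm.
have supE : has_sup E.
  split.
    exists 0; exists 0, (fun=> 0); split; first by rewrite in_itv/= lexx.
      by move=> k; rewrite lexx ler01.
    under [X in tsum X]funext do rewrite oppr0 mul0r.
    by rewrite tsum0 mulr0.
  exists P => _ [s [a [sT a01 ->]]].
  have s0 : 0 <= s by move: sT; rewrite in_itv/= => /andP[].
  apply: (@le_trans _ _ (1 * tsum (fun k => `|f s k|))); last by rewrite mul1r fP1.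
  apply: (@le_trans _ _ (expR (- (lam * s)) * tsum (fun k => `|f s k|))).
    apply: ler_wpM2l; first exact: expR_ge0.
    apply: (le_trans (ler_norm _)); apply: ler_norm_tsum.
      exact/abs_summable_norm/f_summable.
    by move=> k; rewrite normrM ler_piMl// aB.
  apply: ler_wpM2r; first by apply: tsum_ge0 => //; exact/abs_summable_norm/f_summable.
  by rewrite -expR0 ler_expR oppr_le0 mulr_ge0// ltW.
pose M := sup E.
have ME s a : s \in `[0, t] -> (forall k, 0 <= a k <= 1) ->
    tsum (fun k => - a k * f s k) <= M * expR (lam * s).
  move=> sT a01; rewrite mulrC -ler_pdivrMl ?expR_gt0// -expRN.
  by apply: sup_upper_bound => //; exists s, a.
have M0 : 0 <= M.
  have := ME 0 (fun=> 0); rewrite mulr0 expR0 mulr1.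
  under [X in tsum X]funext do rewrite oppr0 mul0r.
  rewrite tsum0; apply; first by rewrite in_itv/= lexx.
  by move=> k; rewrite lexx ler01.
have Nle s : s \in `[0, t] ->
    tsum (fun k => Num.max (- f s k) 0) <= M * expR (lam * s).
  move=> sT; apply: (le_trans _ (ME s (fun k => (f s k <= 0)%R%:R) sT _)).
    rewrite le_eqVlt; apply/orP; left; apply/eqP; congr tsum; apply/funext => k.
    have [h|h] := leP (f s k) 0.
      by rewrite max_l ?oppr_ge0// mulN1r.
    by rewrite max_r ?oppr_le0 ?ltW// oppr0 mul0r.
  by move=> k; case: (f s k <= 0); rewrite /= ?lexx ?ler01.
have Mle : M <= 0.
  have r0 : 0 < lam + 2 * C * P by rewrite addr_gt0// !mulr_gt0.
  suff : M <= (6 * C * P * M) / (lam + 2 * C * P) -> M <= 0.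
    apply; apply: ge_sup; first by case: supE.
    move=> _ [s [a [sT a01 ->]]].
    rewrite expRN ler_pdivrMl ?expR_gt0// mulrC.
    have := @functional_gronwall _ _ _ fC1 (fun k => - a k) 1 (6 * C * P * M)
       (2 * C * P) lam t (aB _ a01) r0 _ s sT.
    move=> H; apply: (le_trans (H _)).
      move=> u ut; have uT : u \in `[0, t].
        by move: ut; rewrite !in_itv/= => /andP[/ltW-> /ltW->].
      have u0 : 0 < u by move: ut; rewrite in_itv/= => /andP[].
      rewrite dfE//.
      apply: (le_trans (collision_neg_bound (f_summable (ltW u0)) (fP1 _ uT) a01)).
      rewrite lerD2r -(mulrA (6 * C * P)); apply: ler_wpM2l.
        by rewrite !mulr_ge0// ltW.
      exact: Nle.
    rewrite -[leRHS]add0r lerD2r; apply: mulr_ge0_le0; first exact: expR_ge0.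
    rewrite subr_le0; apply: (@le_trans _ _ 0).
      rewrite -[leRHS](@tsum0 _ int); apply: ler_tsum.
      - by apply: (abs_summable_bounded (aB _ a01)); exact: f_summable.
      - by rewrite /abs_summable esum1// => i _; rewrite normr0.
      - by move=> k; rewrite mulNr oppr_le0 mulr_ge0//; have /andP[] := a01 k.
    apply: divr_ge0; last exact: ltW.
    by rewrite mulr_ge0// ltW// !mulr_gt0.
  rewrite ler_pdivlMr// /lam.
  have CP0 : 0 < C * P by exact: mulr_gt0.
  have -> : (M * (8 * C * P + 2 * C * P) <= 6 * C * P * M) = (C * P * M <= 0).
    by apply/idP/idP; lra.
  by rewrite pmulr_rle0.
move=> k.
rewrite -oppr_le0; apply: (@le_trans _ _ (Num.max (- f t k) 0)).
  by rewrite le_max lexx.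
apply: (le_trans (ler_term_tsum k _ (abs_summable_neg (f_summable t0)))).
  by move=> j; rewrite le_max lexx orbT.
apply: (le_trans (Nle t _)); first by rewrite in_itv/= t0 lexx.
by rewrite mulr_le0_ge0// expR_ge0.
Qed.

End Positivity.

(** * Relative entropy *)

Section RealInequalities.
Context {R : realType}.

(** The exponential lies above its tangent at the mean [m]; in the average of the two tangent bounds
    the linear terms cancel. *)
Lemma expR_convex (t x y : R) : 0 <= t -> t <= 1 ->
  expR ((1 - t) * x + t * y) <= (1 - t) * expR x + t * expR y.
Proof.
move=> t0 t1; set m := (1 - t) * x + t * y.
have key z : expR m * (1 + (z - m)) <= expR z.
  rewrite -[in leRHS](subrKC m z) (expRD m (z - m)) ler_wpM2l ?expR_ge0//.
  exact: expR_ge1Dx.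
apply: le_trans (lerD (ler_wpM2l _ (key x)) (ler_wpM2l t0 (key y))).
  by rewrite le_eqVlt; apply/orP; left; apply/eqP; rewrite /m; ring.
by rewrite subr_ge0.
Qed.

(** A second-order Taylor bound drawn only from 1 + y <= exp y, taken at y = - x and, for x < 0,
    also at y = x. *)
Lemma expR_le_quadratic (x : R) : expR x <= 1 + x + x ^+ 2 * expR `|x|.
Proof.
have h : expR x - 1 <= x * expR x.
  have := ler_wpM2l (expR_ge0 x) (expR_ge1Dx (- x)).
  by rewrite -expRD subrr expR0; lra.
have h' : expR x <= 1 + x + x * (expR x - 1) by rewrite mulrBr; lra.
apply: (le_trans h'); rewrite lerD2l expr2 -mulrA.
have [x0|x0] := leP 0 x.
  by rewrite ger0_norm// ler_wpM2l.
apply: (@le_trans _ _ (x * x)).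
  by apply: ler_wnM2l; [exact: ltW|have := expR_ge1Dx x; lra].
apply: ler_wnM2l; first exact: ltW.
rewrite -[leRHS]mulr1; apply: ler_wnM2l; first exact: ltW.
by rewrite -expR0 ler_expR.
Qed.

Lemma finite_set_bounded (F : set int) (w : int -> R) : finite_set F ->
  (forall k, 0 <= w k) -> exists B, forall k, k \in F -> w k <= B.
Proof.
move=> finF w0; exists (\sum_(j <- fset_set F) w j) => k kF.
rewrite (big_fsetD1 k) /= ?in_fset_set// lerDl.
exact: sumr_ge0.
Qed.

End RealInequalities.

(** * Dual entropy bounds and one collision step *)

Section Entropy.
Context {R : realType}.

Definition bounded_on {T : Type} (a : T -> R) := exists B, forall k, `|a k| <= B.

Lemma bounded_exp {T : Type} (a : T -> R) : bounded_on a ->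
  bounded_on (fun k => expR (a k)).
Proof.
move=> [B aB]; exists (expR B) => k.
rewrite ger0_norm ?expR_ge0// ler_expR.
exact: le_trans (ler_norm _) (aB k).
Qed.

Lemma bounded_summable {T : choiceType} (a u : T -> R) : bounded_on a ->
  abs_summable u -> abs_summable (fun k => a k * u k).
Proof. by move=> [B aB]; exact: abs_summable_bounded. Qed.

Variable mu : int -> R.
Hypothesis mu_gt0 : forall k, 0 < mu k.
Hypothesis mu_summable : abs_summable mu.
Hypothesis mu_mass : tsum mu = 1.

Definition exp_moment (a : int -> R) : R := tsum (fun k => expR (a k) * mu k).

(* Donsker--Varadhan: [entropy_le f M] says that the relative entropy of [f]
   with respect to [mu] is at most [M]. *)
Definition entropy_le (f : int -> R) (M : R) : Prop := forall a : int -> R,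
  bounded_on a -> tsum (fun k => a k * f k) <= M + ln (exp_moment a).

Lemma exp_moment_bounds (a : int -> R) (B : R) : (forall k, `|a k| <= B) ->
  expR (- B) <= exp_moment a <= expR B.
Proof.
move=> aB.
have sm := bounded_summable (bounded_exp (ex_intro _ B aB)) mu_summable.
rewrite -[expR (- B)]mulr1 -[expR B]mulr1 -mu_mass -!tsumZ//.
apply/andP; split; apply: ler_tsum => //; try exact: abs_summableZ.
- move=> k; apply: ler_wpM2r; first exact: ltW.
  by rewrite ler_expR lerNl; apply: le_trans (aB k); rewrite -normrN ler_norm.
- move=> k; apply: ler_wpM2r; first exact: ltW.
  by rewrite ler_expR; apply: le_trans (aB k); exact: ler_norm.
Qed.

Lemma exp_moment_gt0 a : bounded_on a -> 0 < exp_moment a.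
Proof.
move=> [B aB]; have /andP[+ _] := exp_moment_bounds aB.
by apply: lt_le_trans; exact: expR_gt0.
Qed.

(* The dual bound is applied first in one variable with the other fixed, then to
   the resulting log-moments. *)
Lemma entropy_le_tensor f M (A : int * int -> R) : entropy_le f M ->
  (forall k, 0 <= f k) -> abs_summable f -> tsum f = 1 -> bounded_on A ->
  tsum (fun z => A z * (f z.1 * f z.2)) <=
  2 * M + ln (tsum (fun z => expR (A z) * (mu z.1 * mu z.2))).
Proof.
move=> fM f0 sf f1 [B AB].
have bA : bounded_on A by exists B.
have sff := bounded_summable bA (abs_summable_prod sf sf).
have smm := bounded_summable (bounded_exp bA) (abs_summable_prod mu_summable mu_summable).
have [sf1 ->] := tsum_pair sff.
have [sm1 ->] := tsum_pair smm.
have bAk k : bounded_on (fun l => A (k, l)) by exists B => l; exact: AB.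
pose b k := ln (exp_moment (fun l => A (k, l))).
have bb : bounded_on b.
  exists B => k; have /andP[h1 h2] := exp_moment_bounds (fun l => AB (k, l)).
  have X0 := exp_moment_gt0 (bAk k).
  by rewrite ler_norml -[X in _ <= _ <= X]expRK -[X in X <= _ <= _]expRK
    /b !ler_ln ?posrE ?expR_gt0// h1.
have sbf := bounded_summable bb sf.
apply: (@le_trans _ _ (tsum (fun k => M * f k + b k * f k))).
  apply: ler_tsum => //; first exact: abs_summableD (abs_summableZ M sf) sbf.
  move=> k; rewrite (_ : (fun l => _) = fun l => f k * (A (k, l) * f l)).
    rewrite tsumZ; last exact: bounded_summable.
    by rewrite -mulrDl mulrC ler_wpM2r//; exact: fM.
  by apply/funext => l /=; rewrite mulrCA.
rewrite (tsumD (abs_summableZ M sf) sbf) tsumZ// f1 mulr1.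
have -> : 2 * M = M + M by ring.
rewrite -addrA lerD2l; apply: (le_trans (fM _ bb)).
rewrite lerD2l le_eqVlt; apply/orP; left; apply/eqP; congr ln.
rewrite /exp_moment; congr tsum; apply/funext => k.
rewrite lnK ?posrE ?exp_moment_gt0// /exp_moment -tsumMr.
  by congr tsum; apply/funext => l /=; rewrite -mulrA (mulrC (mu l)).
exact: bounded_summable (bounded_exp (bAk k)) mu_summable.
Qed.

Variables (K : int -> int -> R) (C : R).
Hypothesis K_gt0 : forall k l, 0 < K k l.
Hypothesis K_le : forall k l, K k l <= C.
Hypothesis detailed_balance : forall k l,
  K k l * mu k * mu l = K (l + 1) (k - 1) * mu (l + 1) * mu (k - 1).

Let K_norm k l : `|K k l| <= C. Proof. by rewrite gtr0_norm. Qed.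
Let C_gt0 : 0 < C. Proof. exact: lt_le_trans (K_gt0 0 0) (K_le 0 0). Qed.

(* The pair (k, l) jumps to (k - 1, l + 1) with probability K(k, l) / C: this
   Markov step is reversible for [mu \x mu], hence does not increase the entropy
   of a pair, and its two marginals average to f + Q(f) / (2 C). *)
Lemma entropy_le_collision f M a : entropy_le f M ->
  (forall k, 0 <= f k) -> abs_summable f -> tsum f = 1 -> bounded_on a ->
  tsum (fun k => a k * collision K f k) <=
  2 * C * (M + ln (exp_moment a) - tsum (fun k => a k * f k)).
Proof.
move=> fM f0 sf f1 [B aB]; have ba : bounded_on a by exists B.
pose th (z : int * int) := K z.1 z.2 / C.
have th0 z : 0 <= th z by rewrite divr_ge0// ltW.
have th1 z : th z <= 1 by rewrite ler_pdivrMr ?mul1r.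
pose s0 (z : int * int) := a z.1 + a z.2.
pose s1 (z : int * int) := a (z.1 - 1) + a (z.2 + 1).
(* [A] is the Markov step applied to [s0]. By Jensen, exp A is at most the step applied to exp s0,
   and reversibility leaves the integral of the latter against mu (x) mu unchanged. *)
pose A z := (1 - th z) * s0 z + th z * s1 z.
have B0 : 0 <= B := le_trans (normr_ge0 _) (aB 0).
have s0B z : `|s0 z| <= 2 * B.
  by apply: (le_trans (ler_normD _ _)); move: (aB z.1) (aB z.2); lra.
have s1B z : `|s1 z| <= 2 * B.
  by apply: (le_trans (ler_normD _ _)); move: (aB (z.1 - 1)) (aB (z.2 + 1)); lra.
have bs0 : bounded_on s0 by exists (2 * B).
have bs1 : bounded_on s1 by exists (2 * B).
have bA : bounded_on A.
  exists (2 * B) => z; apply: (le_trans (ler_normD _ _)).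
  rewrite (normrM (1 - th z)) (normrM (th z)).
  rewrite (ger0_norm (th0 z)) ger0_norm ?subr_ge0//.
  have -> : 2 * B = (1 - th z) * (2 * B) + th z * (2 * B) by ring.
  by apply: lerD; apply: ler_wpM2l; rewrite ?subr_ge0.
have H := entropy_le_tensor fM f0 sf f1 bA.
pose e0 z := expR (s0 z).
have be0 : bounded_on e0 by exact: bounded_exp.
have be1 : bounded_on (fun z => expR (s1 z)) by exact: bounded_exp.
have smm := abs_summable_prod mu_summable mu_summable.
have se0 := bounded_summable be0 smm.
have sKm : abs_summable (interaction K mu) by exact: interaction_summable K_norm _.
have sK0 := bounded_summable be0 sKm.
have sK1 := bounded_summable be1 sKm.
have E0 : tsum (fun z => e0 z * (mu z.1 * mu z.2)) = exp_moment a ^+ 2.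
  rewrite expr2 /exp_moment -tsum_prod; [|exact: bounded_summable (bounded_exp ba) _..].
  by congr tsum; apply/funext => z; rewrite /e0 /s0 expRD /=; ring.
have E1 : tsum (fun z => expR (s1 z) * interaction K mu z) =
          tsum (fun z => e0 z * interaction K mu z).
  (* The pair after the jump with its entries swapped: an involution, under which detailed balance
     says that [interaction K mu] is invariant. *)
  pose e (z : int * int) : int * int := (z.2 + 1, z.1 - 1).
  have be : bijective e.
    by exists e => -[k l]; rewrite /e/= ?addrK ?subrK.
  rewrite -(tsum_reindex _ be); congr tsum; apply/funext => z.
  rewrite /e0 /s0 /s1 /e /interaction /= -detailed_balance.
  by rewrite addrK subrK (addrC (a _)).
have X0 := exp_moment_gt0 ba.
have le2 : tsum (fun z => expR (A z) * (mu z.1 * mu z.2)) <= exp_moment a ^+ 2.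
  have sum3 := abs_summableB se0 (abs_summableZ C^-1 sK0).
  have sum4 := abs_summableD sum3 (abs_summableZ C^-1 sK1).
  rewrite -[leRHS]addr0 -(subrr (C^-1 * tsum (fun z => e0 z * interaction K mu z))).
  rewrite -{1}E1 addrA addrAC -E0.
  rewrite -(tsumZ _ sK0) -(tsumZ _ sK1) -tsumB//; last exact: abs_summableZ.
  rewrite -tsumD//; last exact: abs_summableZ.
  apply: ler_tsum => //; first exact: bounded_summable (bounded_exp bA) smm.
  move=> z; have m0 : 0 <= mu z.1 * mu z.2 by rewrite mulr_ge0// ltW.
  apply: (le_trans (ler_wpM2r m0 (expR_convex (s0 z) (s1 z) (th0 z) (th1 z)))).
  by rewrite le_eqVlt; apply/orP; left; apply/eqP; rewrite /e0 /th /interaction; ring.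
have lnX : ln (exp_moment a ^+ 2) = 2 * ln (exp_moment a).
  by rewrite expr2 lnM ?posrE//; ring.
have L0 : 0 < tsum (fun z => expR (A z) * (mu z.1 * mu z.2)).
  have pos z : 0 < expR (A z) * (mu z.1 * mu z.2) by rewrite !mulr_gt0// expR_gt0.
  apply: (lt_le_trans (pos (0, 0))).
  apply: (@ler_term_tsum _ _ (fun z => expR (A z) * (mu z.1 * mu z.2))).
    by move=> z; exact: ltW.
  exact: bounded_summable (bounded_exp bA) smm.
have {}le2 : ln (tsum (fun z => expR (A z) * (mu z.1 * mu z.2))) <=
    2 * ln (exp_moment a).
  by rewrite -lnX ler_ln ?posrE// exprn_gt0.
have sff := abs_summable_prod sf sf.
have sf0 := bounded_summable bs0 sff.
have WE := collision_weak_form K_norm sf aB.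
(* Unit mass of [f] turns [s0] into twice the functional of [a]; the increment th (s1 - s0) gives
   the weak form of Q divided by C. *)
have AE : tsum (fun z => A z * (f z.1 * f z.2)) =
    2 * tsum (fun k => a k * f k) + C^-1 * tsum (fun k => a k * collision K f k).
  have -> : 2 * tsum (fun k => a k * f k) = tsum (fun z => s0 z * (f z.1 * f z.2)).
    have saf := bounded_summable ba sf.
    have p1 := abs_summable_prod saf sf; have p2 := abs_summable_prod sf saf.
    transitivity (tsum (fun z : int * int => a z.1 * f z.1 * f z.2 + f z.1 * (a z.2 * f z.2))).
      by rewrite (tsumD p1 p2) (tsum_prod saf sf) (tsum_prod sf saf) f1; ring.
    by congr tsum; apply/funext => z; rewrite /s0; ring.
  rewrite WE.
  have sW : abs_summable (fun z => interaction K f z *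
      (a (z.2 + 1) - a z.1 - a z.2 + a (z.1 - 1))).
    have := @bounded_summable _ (fun z : int * int =>
      a (z.2 + 1) - a z.1 - a z.2 + a (z.1 - 1)) _ _ (interaction_summable K_norm sf).
    under [X in _ -> abs_summable X]funext do rewrite mulrC.
    apply; exists (4 * B) => z.
    move: (aB (z.2 + 1)) (aB z.1) (aB z.2) (aB (z.1 - 1)).
    by rewrite !ler_norml => /andP[? ?] /andP[? ?] /andP[? ?] /andP[? ?]; lra.
  rewrite -(tsumZ _ sW) -(tsumD sf0 (abs_summableZ _ sW)); congr tsum.
  by apply/funext => z; rewrite /A /th /s0 /s1 /interaction; ring.
move: H; rewrite AE => H.
have {}H : 2 * tsum (fun k => a k * f k) + C^-1 * tsum (fun k => a k * collision K f k)
   <= 2 * (M + ln (exp_moment a)) by apply: (le_trans H); rewrite mulrDr lerD2l.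
rewrite -(ler_pM2l (x := C^-1)) ?invr_gt0//.
rewrite [in leRHS]mulrA mulrCA mulVf ?gt_eqF// mulr1.
by move: H; lra.
Qed.

End Entropy.

(** * Entropy along solutions and its comparison with the weighted norm *)

Section EntropyDecay.
Context {R : realType}.
Variable mu : int -> R.
Hypothesis mu_gt0 : forall k, 0 < mu k.
Hypothesis mu_summable : abs_summable mu.
Hypothesis mu_mass : tsum mu = 1.

Section Solution.
Variables (K : int -> int -> R) (C : R).
Hypothesis K_gt0 : forall k l, 0 < K k l.
Hypothesis K_le : forall k l, K k l <= C.
Hypothesis detailed_balance : forall k l,
  K k l * mu k * mu l = K (l + 1) (k - 1) * mu (l + 1) * mu (k - 1).
Variables (f df : R -> int -> R).
Hypothesis fC1 : C1_l11 f df.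
Hypothesis dfE : forall t : R, 0 < t -> df t = collision K (f t).
Hypothesis f0_ge0 : forall k, 0 <= f 0 k.
Hypothesis f0_mass : tsum (f 0) = 1.

Let f_summable (t : R) : 0 <= t -> abs_summable (f t).
Proof. by case: fC1 => H _ _ _ t0; apply/l11_summable/H. Qed.

(* If M is the supremum of the entropy on [0, T], the comparison argument gives
   the better bound M - exp (- 2 C T) (M - H0), so that M <= H0. *)
Lemma entropy_le_decay (T H0 : R) : 0 <= T -> entropy_le mu (f 0) H0 ->
  (exists M, forall t : R, t \in `[0, T] -> entropy_le mu (f t) M) ->
  entropy_le mu (f T) H0.
Proof.
move=> T0 H0le [M0 M0le].
have C0 : 0 < C := lt_le_trans (K_gt0 0 0) (K_le 0 0).
pose E := [set x | exists (s : R) (a : int -> R), [/\ s \in `[0, T], bounded_on a &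
   x = tsum (fun k => a k * f s k) - ln (exp_moment mu a)]].
have supE : has_sup E.
  split; last first.
    by exists M0 => _ [s [a [sT ba ->]]]; rewrite lerBlDr; exact: M0le.
  exists (tsum (fun k => 0 * f 0 k) - ln (exp_moment mu (fun=> 0))).
  exists 0, (fun=> 0); split; [by rewrite in_itv/= lexx| |by []].
  by exists 0 => k; rewrite normr0.
pose M := sup E.
have Mle (s : R) : s \in `[0, T] -> entropy_le mu (f s) M.
  move=> sT a ba; rewrite -lerBlDr; apply: sup_upper_bound => //.
  by exists s, a.
suff MH : M <= H0.
  move=> a ba; apply: (le_trans (Mle T _ a ba)); first by rewrite in_itv/= T0 lexx.
  by rewrite lerD2r.
rewrite leNgt; apply/negP => H0M.
have c0 := expR_gt0 (- (2 * C) * T).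
suff : M <= M - expR (- (2 * C) * T) * (M - H0).
  by apply/negP; rewrite -ltNge gtrBl mulr_gt0// subr_gt0.
apply: ge_sup; first by case: supE.
move=> _ [s [a [sT ba ->]]]; have [B aB] := ba.
have s0 : 0 <= s by move: sT; rewrite in_itv/= => /andP[].
set X := ln _.
have r0 : 0 < 0 + 2 * C by rewrite add0r mulr_gt0.
have := @functional_gronwall _ _ _ fC1 a B (2 * C * (M + X)) (2 * C) 0 T aB r0 _ s sT.
rewrite mul0r expR0 mulr1 add0r (mulrC (2 * C) (M + X)).
rewrite mulfK ?gt_eqF ?mulr_gt0// (mulrC (M + X)).
move=> H; have {}H := H _.
rewrite lerBlDr; apply: (le_trans (H _)).
  move=> t tT; have t0 : 0 < t by move: tT; rewrite in_itv/= => /andP[].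
  have tT' : t \in `[0, T].
    by move: tT; rewrite !in_itv/= => /andP[/ltW-> /ltW->].
  rewrite mul0r expR0 mulr1 dfE// -mulrBr.
  apply: (@entropy_le_collision _ _ mu_gt0 mu_summable mu_mass _ _ K_gt0 K_le detailed_balance) => //.
  - exact: Mle.
  - exact: (nonneg_preserved K_gt0 K_le fC1 dfE f0_ge0 (ltW t0)).
  - exact/f_summable/ltW.
  - by rewrite (mass_conservation K_gt0 K_le fC1 dfE) ?ltW.
have h0 := H0le a ba; rewrite -/X in h0.
have le1 : expR (- (2 * C) * s) * (tsum (fun k => a k * f 0 k) - (M + X)) <=
    expR (- (2 * C) * s) * (- (M - H0)).
  by apply: ler_wpM2l; [exact: expR_ge0|move: h0; lra].
(* As s <= T, the gain at time s is at least the gain at T, which does not depend on s and so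
   survives the supremum. *)
have le2 : expR (- (2 * C) * T) * (M - H0) <= expR (- (2 * C) * s) * (M - H0).
  apply: ler_wpM2r; first by rewrite subr_ge0 ltW.
  rewrite ler_expR !mulNr lerN2 ler_pM2l ?mulr_gt0//.
  by move: sT; rewrite in_itv/= => /andP[].
move: le1 le2; rewrite mulrN; lra.
Qed.

End Solution.

Hypothesis mu_l11 : l11 mu.

(* With X = sum mu e^a and b = a - ln X, one has b <= D * weight because
   X >= mu e^a; this bound is used on the excess of f over mu, and b <= e^b - 1
   on the minimum of f and mu. *)
Lemma entropy_le_norm (D : R) (f : int -> R) :
  (forall k, expR (- (D * weight k)) <= mu k) -> 0 <= D ->
  l11 f -> (forall k, 0 <= f k) -> tsum f = 1 ->
  entropy_le mu f ((D + 1) * rnorm11 (f - mu)).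
Proof.
move=> muD D0 lf f0 f1 a ba.
have sf := l11_summable lf; have sm := bounded_summable (bounded_exp ba) mu_summable.
have X0 := exp_moment_gt0 mu_gt0 mu_summable mu_mass ba.
set X := exp_moment mu a in X0 *.
have /l11_weighted swg := l11B lf mu_l11.
have aD k : a k - ln X <= D * weight k.
  rewrite lerBlDr -lerBlDl -[leLHS]expRK ler_ln ?posrE ?expR_gt0//.
  apply: (@le_trans _ _ (expR (a k) * mu k)).
    by rewrite expRD ler_wpM2l ?expR_ge0.
  apply: (@ler_term_tsum _ _ (fun k => expR (a k) * mu k)) => // j.
  by rewrite mulr_ge0 ?expR_ge0// ltW.
have expb k : expR (a k - ln X) = expR (a k) / X.
  by rewrite expRD expRN lnK.
have bb : bounded_on (fun k => a k - ln X).
  case: ba => B aB; exists (B + `|ln X|) => k.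
  by apply: (le_trans (ler_normB _ _)); rewrite lerD2r.
have pt k : (a k - ln X) * f k <= expR (a k) * mu k * X^-1 - mu k
    + (D + 1) * (weight k * `|(f - mu) k|).
  rewrite mulrAC -expb.
  set b := a k - ln X; have bD : b <= D * weight k := aD k.
  have w1 := weight_ge1 (R := R) k; have e0 := expR_ge0 b; have e1 := expR_ge1Dx b.
  have m0 := mu_gt0 k; have fk := f0 k.
  have -> : (f - mu) k = f k - mu k by [].
  have [fm|fm] := leP (f k) (mu k).
    rewrite ler0_norm ?subr_le0//.
    have h1 : b * f k <= (expR b - 1) * f k by apply: ler_wpM2r => //; lra.
    have h2 : expR b * f k <= expR b * mu k by exact: ler_wpM2l.
    (* Replacing - f by - mu costs mu - f; the summand 1 of [D + 1] pays for it, since the weight is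
       at least 1. *)
    have h3 : 1 * (mu k - f k) <= ((D + 1) * weight k) * (mu k - f k).
      apply: ler_wpM2r; first by rewrite subr_ge0.
      by rewrite mulrDl mul1r -[leLHS]add0r lerD// mulr_ge0// (le_trans _ w1).
    rewrite opprB mulrA; move: h1 h2 h3; lra.
  rewrite gtr0_norm ?subr_gt0//.
  have h1 : b * mu k <= (expR b - 1) * mu k by apply: ler_wpM2r; [exact: ltW|lra].
  have h2 : b * (f k - mu k) <= ((D + 1) * weight k) * (f k - mu k).
    apply: ler_wpM2r; first by rewrite subr_ge0 ltW.
    by apply: (le_trans bD); rewrite ler_wpM2r ?lerDl// (le_trans _ w1).
  rewrite mulrA; move: h1 h2; lra.
rewrite -lerBlDr.
have -> : tsum (fun k => a k * f k) - ln X = tsum (fun k => (a k - ln X) * f k).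
  have -> : ln X = tsum (fun k => ln X * f k) by rewrite tsumZ// f1 mulr1.
  rewrite -(tsumB (bounded_summable ba sf) (abs_summableZ _ sf)).
  by rewrite tsumZ// f1 mulr1; congr tsum; apply/funext => k; rewrite mulrBl.
have s1 := abs_summableZ X^-1 sm.
have E : (fun k => X^-1 * (expR (a k) * mu k)) = (fun k => expR (a k) * mu k * X^-1).
  by apply/funext => k; rewrite mulrC.
have s1' := s1; rewrite E in s1'.
have s2 := abs_summableB s1' mu_summable.
have s3 := abs_summableZ (D + 1) swg.
apply: (le_trans (ler_tsum (bounded_summable bb sf) (abs_summableD s2 s3) pt)).
rewrite (tsumD s2 s3) (tsumB s1' mu_summable) -E (tsumZ _ sm) (tsumZ _ swg).
by rewrite -/(exp_moment mu a) -/X mulVf ?gt_eqF// mu_mass subrr add0r.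
Qed.

(* Test function: lam * sg (f - mu) * weight on an arbitrary finite set. *)
Lemma norm_le_entropy (eta lam l0 : R) (f : int -> R) : 0 < lam -> lam <= l0 ->
  abs_summable (fun k => mu k * (weight k ^+ 2 * expR (l0 * weight k))) ->
  l11 f -> entropy_le mu f eta ->
  (norm11 (f - mu)%R <= (eta / lam +
     lam * tsum (fun k => mu k * (weight k ^+ 2 * expR (l0 * weight k))))%R%:E)%E.
Proof.
move=> lam0 laml0 s2 lf fe; set S2 := tsum _.
(* The norm is a supremum over finite sets, and cutting off at [F] makes the linearly growing test
   function bounded, hence admissible. *)
apply: ge_ereal_sup => _ [F [finF _] <-].
pose u k : R := weight k * `|f k - mu k|.
have w0 k : 0 <= weight (R := R) k by rewrite ltW ?weight_gt0.
have u0 k : 0 <= u k by rewrite mulr_ge0.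
pose v k : R := if k \in F then u k else 0.
have v0 k : 0 <= v k by rewrite /v; case: ifP.
have /l11_weighted su : l11 (f - mu) := l11B lf mu_l11.
have sv : abs_summable v.
  apply: abs_summable_le su => k; rewrite ger0_norm// /v; case: ifP => // _.
  exact: u0.
apply: (@le_trans _ _ (tsum v)%:E).
  rewrite -(esum_ge0_fine v0 sv); apply: esum_ge; exists F => //.
  rewrite le_eqVlt; apply/orP; left; apply/eqP; apply: eq_fsbigr => k kF.
  by rewrite /v kF.
rewrite lee_fin.
pose a k : R := if k \in F then lam * Num.sg (f k - mu k) * weight k else 0.
have al k : `|a k| <= lam * weight k.
  rewrite /a; case: ifP => _; last by rewrite normr0 mulr_ge0// ltW.
  rewrite !normrM (gtr0_norm lam0) (ger0_norm (w0 k)) normr_sg.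
  by apply: ler_wpM2r => //; rewrite ler_piMr ?lern1 ?leq_b1// ltW.
have ba : bounded_on a.
  have [B FB] := finite_set_bounded finF w0.
  exists (lam * `|B|) => k; rewrite /a; case: ifPn => kF; last first.
    by rewrite normr0 mulr_ge0// ltW.
  have := al k; rewrite /a kF => /le_trans; apply; rewrite ler_pM2l//.
  by apply: (le_trans (FB _ kF)); exact: ler_norm.
have saf := bounded_summable ba (l11_summable lf).
have sam := bounded_summable ba mu_summable.
have avE : lam * tsum v = tsum (fun k => a k * f k) - tsum (fun k => a k * mu k).
  rewrite -tsumZ// -(tsumB saf sam); congr tsum; apply/funext => k.
  rewrite -mulrBr /v /a /u; case: ifP => _; last by rewrite mulr0 mul0r.
  by rewrite normrEsg; ring.
have X0 := exp_moment_gt0 mu_gt0 mu_summable mu_mass ba.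
have lnX : ln (exp_moment mu a) <= exp_moment mu a - 1.
  rewrite -[X in ln X](subrKC 1); apply: le_ln1Dx.
  by rewrite ltrBrDr addNr.
have sX := bounded_summable (bounded_exp ba) mu_summable.
(* The first-order term cancels the [mu] part of [avE]. The error is then quadratic in lam, and
   dividing by lam leaves lam * S2. *)
have XS : exp_moment mu a - 1 <= tsum (fun k => a k * mu k) + lam ^+ 2 * S2.
  rewrite lerBlDl -mu_mass /exp_moment -(tsumZ _ s2) -(tsumD sam (abs_summableZ _ s2)).
  rewrite -(tsumD mu_summable (abs_summableD sam (abs_summableZ _ s2))).
  apply: ler_tsum => //.
    exact: abs_summableD mu_summable (abs_summableD sam (abs_summableZ _ s2)).
  move=> k; have m0 := ltW (mu_gt0 k).
  apply: (le_trans (ler_wpM2r m0 (expR_le_quadratic (a k)))).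
  have -> : mu k + (a k * mu k + lam ^+ 2 * (mu k * (weight k ^+ 2 * expR (l0 * weight k))))
     = (1 + a k + (lam * weight k) ^+ 2 * expR (l0 * weight k)) * mu k by ring.
  apply: ler_wpM2r => //; rewrite lerD2l.
  apply: ler_pM; [exact: sqr_ge0|exact: expR_ge0| |].
    by rewrite -real_normK ?num_real// ler_sqr ?nnegrE ?mulr_ge0// ltW.
  by rewrite ler_expR (le_trans (al k))// ler_wpM2r.
have := fe a ba => H.
rewrite -(ler_pM2l lam0) avE mulrDr (mulrCA lam eta) mulfV ?gt_eqF// mulr1 mulrA -expr2.
by move: H lnX XS; lra.
Qed.

End EntropyDecay.

(** * Exponential bounds on the equilibrium *)

Section Geometric.
Context {R : realType}.

Lemma abs_summable_geometric (q : R) : 0 <= q -> q < 1 ->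
  abs_summable (fun n : nat => q ^+ n).
Proof.
move=> q0 q1; rewrite /abs_summable -nneseries_esumT; last first.
  by move=> n; rewrite lee_fin.
apply: (@le_lt_trans _ _ ((1 - q)^-1)%:E); last exact: ltry.
apply: lime_le; first by apply: is_cvg_nneseries => n _ _; rewrite lee_fin.
apply: nearW => n; rewrite sumEFin lee_fin.
have q10 : 0 < 1 - q by rewrite subr_gt0.
rewrite -[leRHS]mul1r ler_pdivlMr//.
have -> : (\sum_(0 <= i < n) `|q ^+ i|) * (1 - q) = 1 - q ^+ n.
  elim: n => [|n IH]; first by rewrite big_geq// mul0r subrr.
  by rewrite big_nat_recr//= mulrDl IH ger0_norm ?exprn_ge0// exprS; ring.
by rewrite lerBlDr lerDl exprn_ge0.
Qed.

Lemma abs_summable_geometric_int (q : R) : 0 <= q -> q < 1 ->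
  abs_summable (fun k : int => q ^+ `|k|%N).
Proof.
move=> q0 q1.
pose e (z : bool * nat) : int := if z.1 then Negz z.2 else Posz z.2.
pose e' (k : int) : bool * nat := match k with Posz n => (false, n) | Negz n => (true, n) end.
have be : bijective e'.
  by exists e => [[n|n]|[[] n]].
have s1 : abs_summable (fun _ : bool => 1 : R).
  rewrite /abs_summable (_ : [set: bool] = [set true] `|` [set false]); last first.
    by apply/seteqP; split=> [[]|] //= _; [left|right].
  rewrite (esumID [set true]) => [|i _]; last by rewrite lee_fin.
  rewrite (_ : _ `&` [set true] = [set true]); last first.
    by apply/seteqP; split=> [b []|b ->] //; split=> //; left.
  rewrite (_ : _ `&` ~` [set true] = [set false]); last first.
    by apply/seteqP; split=> [b [[]//]|b ->]; split=> //; right.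
  by rewrite !esum_set1 ?lee_fin// normr1 -EFinD ltry.
have s2 := abs_summable_geometric q0 q1.
have := abs_summable_reindex be (abs_summable_prod s1 s2).
apply: abs_summable_le => -[n|n]; rewrite /= mul1r ger0_norm ?exprn_ge0//.
by rewrite exprS ler_piMl ?exprn_ge0// ltW.
Qed.

(** Induction on [N] shifts the sequence by one and absorbs its first term into the constant [A]. *)
Lemma ratio_bound (x : nat -> R) (q : R) (N : nat) : 0 < q ->
  (forall n, (N <= n)%N -> x n.+1 <= q * x n) ->
  exists A, 0 < A /\ forall n, x n <= A * q ^+ n.
Proof.
move=> q0; elim: N x => [|N IH] x H.
  exists (1 + `|x 0%N|); split; first by rewrite ltr_pwDl.
  elim=> [|n IHn]; first by rewrite mulr1 (le_trans (ler_norm _))// lerDr.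
  apply: (le_trans (H n isT)); rewrite exprS mulrCA.
  by rewrite ler_pM2l.
have [A [A0 HA]] := IH (fun n => x n.+1) (fun n Nn => H n.+1 Nn).
exists (`|x 0%N| + A / q); split; first by rewrite ltr_wpDl// divr_gt0.
have Aq : 0 < A / q by rewrite divr_gt0.
case=> [|n]; first by rewrite mulr1 (le_trans (ler_norm _))// lerDl ltW.
apply: (le_trans (HA n)); rewrite exprS mulrA; apply: ler_wpM2r.
  by rewrite exprn_ge0// ltW.
by rewrite mulrDl divfK ?gt_eqF// lerDr mulr_ge0// ltW.
Qed.

(** Ratios eventually above c = (1 + L) / 2 > 1 force geometric decay at rate 1 / c. Ratios
    eventually below L + 1 bound the growth of the inverses 1 / x, which is the lower bound. *)
Lemma ratio_limit_bounds (x : nat -> R) (L : R) : (forall n, 0 < x n) ->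
  x n / x n.+1 @[n --> \oo] --> L -> 1 < L ->
  (exists A q, [/\ 0 < q, q < 1 & forall n, x n <= A * q ^+ n]) /\
  (exists D, 0 <= D /\ forall n, expR (- (D * (1 + n%:R))) <= x n).
Proof.
move=> x0 xL L1; pose c := (1 + L) / 2.
have c1 : 1 < c by rewrite /c; lra.
have cL : c < L by rewrite /c; lra.
have c0 : 0 < c by lra.
have [N _ HN] : \forall n \near \oo, c < x n / x n.+1.
  by apply: (cvgr_gt _ xL).
have [N' _ HN'] : \forall n \near \oo, x n / x n.+1 < L + 1.
  by apply: (cvgr_lt _ xL); lra.
split.
  have [A [A0 HA]] : exists A, 0 < A /\ forall n, x n <= A * c^-1 ^+ n.
    apply: (@ratio_bound _ _ N); rewrite ?invr_gt0// => n Nn.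
    have := HN n Nn; rewrite /= ltr_pdivlMr// => /ltW h.
    by rewrite ler_pdivlMl.
  by exists A, c^-1; split; rewrite ?invr_gt0// invf_lt1.
have L0 : 0 < L + 1 by lra.
have [A [A0 HA]] : exists A, 0 < A /\ forall n, (x n)^-1 <= A * (L + 1) ^+ n.
  apply: (@ratio_bound _ _ N') => // n Nn.
  have := HN' n Nn; rewrite /= ltr_pdivrMr// => /ltW h.
  by rewrite ler_pdivlMr// ler_pdivrMl// mulrC.
exists (`|ln A| + ln (L + 1)).
have l0 : 0 <= ln (L + 1) by rewrite ln_ge0//; lra.
split=> [|n]; first by rewrite addr_ge0.
rewrite expRN -[leRHS]invrK lef_pV2 ?posrE ?invr_gt0 ?expR_gt0//.
apply: (le_trans (HA n)).
have -> : A * (L + 1) ^+ n = expR (ln A + n%:R * ln (L + 1)).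
  by rewrite expRD lnK// expRM_natl lnK.
rewrite ler_expR mulrDl; apply: lerD.
  by apply: (le_trans (ler_norm _)); rewrite ler_peMr// lerDl.
by rewrite mulrC ler_wpM2l// lerDr.
Qed.

(** The rate [d] is chosen so that q e^d is the square root of q. Half of it goes to the
    exponential; the other half absorbs the squared weight w^2 through (d w / 4)^2 <= e^(d w / 2),
    whence the constant 16 / d^2. *)
Lemma geometric_exp_moment (m : int -> R) (A q : R) : 0 < q -> q < 1 ->
  (forall k, 0 <= m k) -> (forall k, m k <= A * q ^+ `|k|%N) ->
  exists l0, 0 < l0 /\
    abs_summable (fun k => m k * (weight k ^+ 2 * expR (l0 * weight k))).
Proof.
move=> q0 q1 m0 mq; pose d := - ln q / 2.
have lq : ln q < 0 by rewrite ln_lt0// q0.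
have d0 : 0 < d by rewrite /d; lra.
exists (d / 2); split; first by rewrite divr_gt0.
pose r := q * expR d.
have r0 : 0 <= r by rewrite mulr_ge0 ?expR_ge0// ltW.
have r1 : r < 1.
  rewrite /r -[q in X in X < _]lnK ?posrE// -expRD -expR0 ltr_expR /d; lra.
have sg := abs_summable_geometric_int r0 r1.
apply: abs_summable_le (abs_summableZ (A * (16 / d ^+ 2) * expR d) sg) => k.
have w0 : 0 < weight (R := R) k := weight_gt0 k.
rewrite ger0_norm; last by rewrite !mulr_ge0 ?expR_ge0// ltW.
have h1 : weight k ^+ 2 * expR (d / 2 * weight k) <=
    16 / d ^+ 2 * expR (d * weight k).
  have -> : weight k ^+ 2 = 16 / d ^+ 2 * (d / 4 * weight k) ^+ 2.
    by field; rewrite gt_eqF.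
  rewrite -(mulrA (16 / d ^+ 2)); apply: ler_wpM2l.
    by rewrite divr_ge0// exprn_ge0// ltW.
  have -> : expR (d * weight k) = expR (d / 4 * weight k) ^+ 2 * expR (d / 2 * weight k).
    by rewrite expr2 -!expRD; congr expR; field.
  apply: ler_wpM2r; first exact: expR_ge0.
  have y0 : 0 <= d / 4 * weight k.
    by apply: mulr_ge0; [apply: divr_ge0 => //|]; exact: ltW.
  rewrite ler_sqr ?nnegrE ?expR_ge0//.
  by apply: le_trans (expR_ge1Dx _); rewrite lerDr.
have h2 : expR (d * weight k) = expR d * expR d ^+ `|k|%N.
  rewrite -expRM_natr -expRD; congr expR.
  by rewrite /weight mulrDr mulr1 -abszE.
have A0 : 0 <= A * q ^+ `|k|%N := le_trans (m0 k) (mq k).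
apply: (le_trans (ler_pM (m0 k) _ (mq k) h1)).
  by rewrite mulr_ge0 ?expR_ge0// exprn_ge0// ltW.
by rewrite h2 le_eqVlt; apply/orP; left; apply/eqP; rewrite /r (exprMn _ q (expR d)); ring.
Qed.

End Geometric.

(** * The equilibrium: detailed balance, tails and normalisation *)

Section Equilibrium.
Context {R : realType}.
Variable K : int -> int -> R.
Hypothesis K_gt0 : forall k l, 0 < K k l.

Lemma kappa_gt0 : 0 < kappa K.
Proof. by rewrite sqrtr_gt0 divr_gt0. Qed.

Let kp := kappa K.
Let kp_neq0 : kp != 0. Proof. by rewrite gt_eqF ?kappa_gt0. Qed.

Lemma psi0 : psi K 0 = 1.
Proof. by rewrite /psi /psi_tilde lexx /= big_geq// expr0z mulr1. Qed.

Lemma psi_succ (n : nat) :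
  psi K n.+1%:Z = psi K n%:Z * (K 1 n%:Z / K n.+1%:Z 0) / kappa K.
Proof.
rewrite /psi /psi_tilde !le0z_nat /= big_nat_recr//=.
rewrite -!abszE /= -!exprnN exprSr invfM.
have -> : n.+1%:Z - 1 = n%:Z by rewrite -addn1 PoszD addrK.
by rewrite -/kp; ring.
Qed.

Lemma psi_pred (n : nat) :
  psi K (- n.+1%:Z) = psi K (- n%:Z) *
    (K (- n%:Z) (-1) / K 0 (- n.+1%:Z)) / kappa K.
Proof.
have psiN (m : nat) : psi K (- m%:Z) =
    (\prod_(1 <= j < m.+1) (K (- j%:Z + 1) (-1) / K 0 (- j%:Z))) * kappa K ^- m.
  rewrite /psi /psi_tilde abszN absz_nat normrN -abszE absz_nat -exprnN.
  by case: m => [|m] //=; rewrite !big_geq.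
rewrite !psiN big_nat_recr//= exprSr invfM.
have -> : - n.+1%:Z + 1 = - n%:Z by rewrite -addn1 PoszD opprD addrNK.
by rewrite -/kp; ring.
Qed.

Lemma psi_gt0 k : 0 < psi K k.
Proof.
rewrite /psi mulr_gt0 ?exprz_gt0 ?kappa_gt0// /psi_tilde.
by case: ifP => _; apply: prodr_gt0 => j _; rewrite divr_gt0.
Qed.

Section Balance.
Variable g : int -> R.
Hypothesis g_gt0 : forall k, 0 < g k.
Hypothesis g_balance : forall k l : int,
  K k (l - 1) * g k * g (l - 1) = K l (k - 1) * g l * g (k - 1).

(** Multiplying [g] by a constant and by theta^k respects the balance condition, because jumps
    preserve k + l; so this identity lets the product formula for [psi] inherit detailed balance. *)
Lemma psi_balance k : psi K k = g k / g 0 * (g 0 / (g 1 * kappa K)) ^ k.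
Proof.
have g0 j : g j != 0 by rewrite gt_eqF.
have K0 i j : K i j != 0 by rewrite gt_eqF.
rewrite -/kp.
have th0 : g 0 / (g 1 * kp) != 0.
  by rewrite mulf_neq0 ?invr_neq0 ?mulf_neq0.
(* The balance at (1, 0) explains the choice of kappa: with it the geometric factors found on the
   two half-lines are powers of the same number. *)
have kp2 : kp ^+ 2 * (g 1 * g (-1)) = g 0 ^+ 2.
  rewrite /kp /kappa sqr_sqrtr; last by rewrite divr_ge0// ltW.
  have := g_balance 1 0; rewrite add0r subrr => e.
  have -> : K 1 (-1) / K 0 0 * (g 1 * g (-1)) = K 1 (-1) * g 1 * g (-1) / K 0 0.
    by ring.
  by rewrite e; field.
have pos n : psi K n%:Z = g n%:Z / g 0 * (g 0 / (g 1 * kp)) ^+ n.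
  elim: n => [|n IH]; first by rewrite psi0 expr0 mulr1 divff.
  rewrite psi_succ IH -/kp exprS.
  have := g_balance n.+1%:Z 1.
  have -> : n.+1%:Z - 1 = n%:Z by rewrite -addn1 PoszD addrK.
  rewrite subrr => e.
  have -> : K 1 n%:Z = K n.+1%:Z 0 * g n.+1%:Z * g 0 / (g 1 * g n%:Z).
    by rewrite e; field; rewrite !g0.
  by field; rewrite !g0 K0 kp_neq0.
have neg n : psi K (- n%:Z) = g (- n%:Z) / g 0 * (g 0 / (g 1 * kp)) ^- n.
  elim: n => [|n IH]; first by rewrite oppr0 psi0 expr0 invr1 mulr1 divff.
  rewrite psi_pred IH -/kp exprS (invfM _ (_ ^+ n)).
  have := g_balance (- n%:Z) 0.
  have -> : - n%:Z - 1 = - n.+1%:Z by rewrite -opprD -PoszD addn1.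
  rewrite add0r => e.
  have -> : K (- n%:Z) (-1) = K 0 (- n.+1%:Z) * g 0 * g (- n.+1%:Z) / (g (- n%:Z) * g (-1)).
    by rewrite -e; field; rewrite !g0.
  have -> : (g 0 / (g 1 * kp))^-1 = g 0 / (g (-1) * kp).
    apply: (mulIf th0); rewrite mulVf//.
    have -> : g 0 / (g (-1) * kp) * (g 0 / (g 1 * kp)) = g 0 ^+ 2 / (kp ^+ 2 * (g 1 * g (-1))).
      by field; rewrite !g0 kp_neq0.
    by rewrite kp2 divff// expf_neq0.
  set X := _ ^- n.
  by field; rewrite !g0 K0 kp_neq0.
case: k => n; first exact: pos.
by rewrite NegzE neg -exprnN.
Qed.

End Balance.

Section Bounds.
Variables (Lm Lp : \bar R) (phi : R).
Hypothesis Lp_gt0 : (0 < Lp)%E.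
Hypothesis Lp_lim : (K n%:Z 0 / K 1 (n%:Z - 1))%:E @[n --> \oo] --> Lp.
Hypothesis Lm_gt0 : (0 < Lm)%E.
Hypothesis Lm_lim : (K 0 (- n%:Z) / K (- n%:Z + 1) (-1))%:E @[n --> \oo] --> Lm.
Hypothesis Lp_fin : (Lp < +oo)%E.
Hypothesis Lm_fin : (Lm < +oo)%E.
Hypothesis phiI : I_K K Lm Lp phi.

(** Since [Lm] is finite, the lower endpoint of [I_K] is positive, and so is phi. The two other
    quantities are the limits of successive ratios of psi(k) phi^k towards plus and minus infinity;
    membership in [I_K] says that both exceed 1. *)
Lemma I_K_fine : [/\ 0 < phi, 1 < fine Lp * kappa K / phi &
  1 < fine Lm * kappa K * phi].
Proof.
have k0 := kappa_gt0.
move: Lp_gt0 Lp_fin Lm_gt0 Lm_fin phiI.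
case: (Lp) => // lp; case: (Lm) => // lm; rewrite !lte_fin /I_K /=.
move=> lp0 _ lm0 _; rewrite -!EFinM inver gt_eqF ?mulr_gt0// !lte_fin => -[h1 h2].
have p0 : 0 < phi by apply: lt_trans h1; rewrite invr_gt0 mulr_gt0.
split=> //; first by rewrite ltr_pdivlMr// mul1r.
by move: h1; rewrite -ltr_pdivrMl ?mulr_gt0// mulr1.
Qed.

Let m (k : int) : R := psi K k * phi ^ k.

Let m_gt0 k : 0 < m k.
Proof. by case: I_K_fine => p0 _ _; rewrite mulr_gt0 ?psi_gt0 ?exprz_gt0. Qed.

Let ratio_pos : m n%:Z / m n.+1%:Z @[n --> \oo] --> fine Lp * kappa K / phi.
Proof.
have [p0 _ _] := I_K_fine.
have -> : (fun n : nat => m n%:Z / m n.+1%:Z) =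
   (fun n : nat => K n.+1%:Z 0 / K 1 (n.+1%:Z - 1) * kappa K / phi).
  apply/funext => n; rewrite /m psi_succ.
  have -> : n.+1%:Z - 1 = n%:Z by rewrite -addn1 PoszD addrK.
  rewrite -[phi ^ n.+1%:Z]/(phi ^+ n.+1) exprS -[phi ^ n%:Z]/(phi ^+ n).
  by field; rewrite !gt_eqF ?psi_gt0 ?kappa_gt0 ?exprn_gt0.
apply: cvgM; last exact: cvg_cst.
apply: cvgM; last exact: cvg_cst.
have := Lp_lim; rewrite -(cvg_shiftS (fun n => (K n%:Z 0 / K 1 (n%:Z - 1))%:E)).
have {1}-> : Lp = (fine Lp)%:E.
  by rewrite fineK// ge0_fin_numE// ltW.
by move=> /fine_cvgP[_].
Qed.

Let ratio_neg : m (- n%:Z) / m (- n.+1%:Z) @[n --> \oo] --> fine Lm * kappa K * phi.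
Proof.
have [p0 _ _] := I_K_fine.
have -> : (fun n : nat => m (- n%:Z) / m (- n.+1%:Z)) =
   (fun n : nat => K 0 (- n.+1%:Z) / K (- n.+1%:Z + 1) (-1) * kappa K * phi).
  apply/funext => n; rewrite /m psi_pred.
  have -> : - n.+1%:Z + 1 = - n%:Z by rewrite -addn1 PoszD opprD addrNK.
  rewrite -!exprnN exprS invfM.
  have pn : phi ^+ n != 0 by rewrite expf_neq0// gt_eqF.
  by field; rewrite pn !gt_eqF ?psi_gt0 ?kappa_gt0.
apply: cvgM; last exact: cvg_cst.
apply: cvgM; last exact: cvg_cst.
have := Lm_lim; rewrite -(cvg_shiftS (fun n => (K 0 (- n%:Z) / K (- n%:Z + 1) (-1))%:E)).
have {1}-> : Lm = (fine Lm)%:E.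
  by rewrite fineK// ge0_fin_numE// ltW.
by move=> /fine_cvgP[_].
Qed.

Lemma unnormalised_upper : exists A q : R,
  [/\ 0 < q, q < 1 & forall k : int, psi K k * phi ^ k <= A * q ^+ `|k|%N].
Proof.
have [p0 h1 h2] := I_K_fine.
have [[A [q [q0 q1 H]]] _] := ratio_limit_bounds (fun n => m_gt0 _) ratio_pos h1.
have [[A' [q' [q0' q1' H']]] _] := ratio_limit_bounds (fun n => m_gt0 _) ratio_neg h2.
have A0 : 0 <= A by have := H 0%N; rewrite expr0 mulr1; apply: le_trans; exact: ltW.
have A0' : 0 <= A' by have := H' 0%N; rewrite expr0 mulr1; apply: le_trans; exact: ltW.
have le (a b x y : R) n : 0 <= a -> a <= b -> 0 <= x -> x <= y -> a * x ^+ n <= b * y ^+ n.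
  move=> a0 ab x0 xy; apply: ler_pM => //; first exact: exprn_ge0.
  by apply: lerXn2r => //; rewrite nnegrE// (le_trans x0).
exists (A + A'), (Num.max q q'); split.
- by rewrite lt_max q0.
- by rewrite gt_max q1.
- case=> n.
    apply: (le_trans (H n)); apply: le => //; [by rewrite lerDl|exact: ltW|].
    by rewrite le_max lexx.
  rewrite NegzE; apply: (le_trans (H' n.+1)); rewrite abszN.
  apply: le => //; [by rewrite lerDr|exact: ltW|].
  by rewrite le_max lexx orbT.
Qed.

Lemma unnormalised_lower : exists D : R, 0 <= D /\
  forall k : int, expR (- (D * weight k)) <= psi K k * phi ^ k.
Proof.
have [p0 h1 h2] := I_K_fine.
have [_ [D [D0 H]]] := ratio_limit_bounds (fun n => m_gt0 _) ratio_pos h1.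
have [_ [D' [D0' H']]] := ratio_limit_bounds (fun n => m_gt0 _) ratio_neg h2.
exists (D + D'); split=> [|k]; first exact: addr_ge0.
have w0 : 0 <= weight (R := R) k by rewrite ltW ?weight_gt0.
have : weight (R := R) k = 1 + `|k|%N%:R by rewrite /weight -abszE.
case: k w0 => n w0 e.
  by apply: le_trans (H n); rewrite ler_expR lerN2 mulrDl e lerDl mulr_ge0.
rewrite NegzE; apply: le_trans (H' n.+1).
by rewrite ler_expR lerN2 mulrDl -NegzE e lerDr mulr_ge0// addr_ge0.
Qed.

Lemma unnormalised_exp_moment : exists l0 : R, 0 < l0 /\
  abs_summable (fun k => (psi K k * phi ^ k) * (weight k ^+ 2 * expR (l0 * weight k))).
Proof.
have [A [q [q0 q1 H]]] := unnormalised_upper.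
by apply: geometric_exp_moment q0 q1 _ H => k; exact: ltW (m_gt0 k).
Qed.

Lemma unnormalised_summable : abs_summable (fun k => psi K k * phi ^ k).
Proof.
have [l0 [l00 sm]] := unnormalised_exp_moment.
apply: abs_summable_le sm => k; rewrite (ger0_norm (ltW (m_gt0 k))).
rewrite -[leLHS]mulr1; apply: ler_wpM2l; first exact: ltW (m_gt0 k).
have w1 := weight_ge1 (R := R) k.
rewrite -[leLHS]mulr1; apply: ler_pM => //; first exact: exprn_ege1.
by rewrite -expR0 ler_expR mulr_ge0// ?(le_trans ler01 w1)// ltW.
Qed.

Lemma partition_fun_gt0 : 0 < partition_fun K phi.
Proof.
apply: (lt_le_trans (m_gt0 0)).
apply: (ler_term_tsum 0 _ unnormalised_summable) => k; exact: ltW (m_gt0 k).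
Qed.

Lemma equilibrium_gt0 k : 0 < equilibrium K phi k.
Proof. exact: divr_gt0 (m_gt0 k) partition_fun_gt0. Qed.

Lemma equilibrium_summable : abs_summable (equilibrium K phi).
Proof.
rewrite /equilibrium; under [X in abs_summable X]funext do rewrite mulrC.
exact: abs_summableZ unnormalised_summable.
Qed.

Lemma equilibrium_mass : tsum (equilibrium K phi) = 1.
Proof.
rewrite /equilibrium tsumMr; last exact: unnormalised_summable.
by rewrite mulfV// gt_eqF// partition_fun_gt0.
Qed.

Lemma equilibrium_exp_moment : exists l0 : R, 0 < l0 /\
  abs_summable (fun k => equilibrium K phi k * (weight k ^+ 2 * expR (l0 * weight k))).
Proof.
have [l0 [l00 sm]] := unnormalised_exp_moment; exists l0; split=> //.
rewrite /equilibrium; under [X in abs_summable X]funext do rewrite mulrAC mulrC.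
exact: abs_summableZ sm.
Qed.

Lemma equilibrium_l11 : l11 (equilibrium K phi).
Proof.
apply/l11_weighted; have [l0 [l00 sm]] := equilibrium_exp_moment.
apply: abs_summable_le sm => k; have e0 := ltW (equilibrium_gt0 k).
have w1 := weight_ge1 (R := R) k; have w0 : 0 <= weight (R := R) k := le_trans ler01 w1.
rewrite (ger0_norm e0) (ger0_norm (mulr_ge0 w0 e0)) mulrC.
apply: ler_wpM2l => //.
rewrite expr2 -mulrA ler_peMr// -[leLHS]mulr1; apply: ler_pM => //.
by rewrite -expR0 ler_expR mulr_ge0// ltW.
Qed.

Lemma equilibrium_lower : exists D : R, 0 <= D /\
  forall k : int, expR (- (D * weight k)) <= equilibrium K phi k.
Proof.
have [D [D0 H]] := unnormalised_lower; have Z0 := partition_fun_gt0.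
(* The factor 1 / Z fits into the exponent because the weight is at least 1. *)
exists (D + `|ln (partition_fun K phi)|); split=> [|k]; first exact: addr_ge0.
have w1 := weight_ge1 (R := R) k.
rewrite /equilibrium -[(partition_fun K phi)^-1]lnK ?posrE ?invr_gt0//.
apply: le_trans (ler_wpM2r (expR_ge0 _) (H k)).
rewrite -expRD ler_expR lnV ?posrE// mulrDl opprD lerD2l lerN2.
by apply: (le_trans (ler_norm _)); rewrite ler_peMr.
Qed.

(** Besides [g], the product of the densities at x and y depends only on x + y (claim [F]), which
    the jump from (k, l) to (l + 1, k - 1) preserves. *)
Lemma equilibrium_detailed_balance (g : int -> R) : (forall k, 0 < g k) ->
  (forall k l : int,
    K k (l - 1) * g k * g (l - 1) = K l (k - 1) * g l * g (k - 1)) ->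
  let mu := equilibrium K phi in forall k l,
  K k l * mu k * mu l = K (l + 1) (k - 1) * mu (l + 1) * mu (k - 1).
Proof.
move=> g0 gb /= k l; rewrite /equilibrium !(psi_balance g0 gb).
set th := g 0 / (g 1 * kappa K); set Z := partition_fun K phi.
have [p0 _ _] := I_K_fine.
have th0 : th != 0 by rewrite gt_eqF// divr_gt0// mulr_gt0// kappa_gt0.
have phi0 : phi != 0 by rewrite gt_eqF.
clearbody th Z.
have F x y : (g x / g 0 * th ^ x * phi ^ x / Z) * (g y / g 0 * th ^ y * phi ^ y / Z)
    = g x * g y * ((g 0)^-1 ^+ 2 * Z^-1 ^+ 2) * (th * phi) ^ (x + y).
  by rewrite expfzDr ?mulf_neq0// !exprzMl ?unitfE//; ring.
rewrite -[LHS]mulrA -[RHS]mulrA !F.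
have -> : l + 1 + (k - 1) = k + l by rewrite addrACA subrr addr0 addrC.
have := gb k (l + 1); rewrite addrK => e.
set c := (g 0)^-1 ^+ 2 * _; set r := _ ^ (k + l).
by transitivity (K k l * g k * g l * (c * r)); [ring|rewrite e; ring].
Qed.

End Bounds.
End Equilibrium.

(** * Stability: choice of the constants *)

Theorem theorem7p3 (R : realType) (K : int -> int -> R)
  (K_gt0 : forall k l : int, 0 < K k l)
  (K_bounded : exists C_K : R, 0 < C_K /\ forall k l : int, K k l <= C_K)
  (K_balance : exists g : int -> R, (forall k : int, 0 < g k) /\
     forall k l : int,
       K k (l - 1) * g k * g (l - 1) = K l (k - 1) * g l * g (k - 1))
  (Lm Lp : \bar R)
  (Lp_gt0 : (0 < Lp)%E)
  (Lp_lim : (K n%:Z 0 / K 1 (n%:Z - 1))%:E @[n --> \oo] --> Lp)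
  (Lm_gt0 : (0 < Lm)%E)
  (Lm_lim : (K 0 (- n%:Z) / K (- n%:Z + 1) (-1))%:E @[n --> \oo] --> Lm)
  (I_K_neq0 : I_K K Lm Lp !=set0)
  (Lp_fin : (Lp < +oo)%E)
  (Lm_fin : (Lm < +oo)%E) :
  forall phi : R, I_K K Lm Lp phi ->
  forall eps : R, 0 < eps ->
  exists delta : R, 0 < delta /\
    forall f0 : int -> R, P11 f0 ->
      (norm11 (f0 - equilibrium K phi)%R < delta%:E)%E ->
    forall f : R -> int -> R, is_solution K f0 f ->
    forall t : R, 0 <= t ->
      (norm11 (f t - equilibrium K phi)%R < eps%:E)%E.
Proof.
move=> phi phiI eps eps0.
have [C [C0 K_le]] := K_bounded; have [g [g_gt0 gb]] := K_balance.
pose mu := equilibrium K phi.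
have mu_gt0 : forall k, 0 < mu k :=
  equilibrium_gt0 K_gt0 Lp_gt0 Lp_lim Lm_gt0 Lm_lim Lp_fin Lm_fin phiI.
have mu_sum : abs_summable mu :=
  equilibrium_summable K_gt0 Lp_gt0 Lp_lim Lm_gt0 Lm_lim Lp_fin Lm_fin phiI.
have mu_mass : tsum mu = 1 :=
  equilibrium_mass K_gt0 Lp_gt0 Lp_lim Lm_gt0 Lm_lim Lp_fin Lm_fin phiI.
have mu_l11 : l11 mu :=
  equilibrium_l11 K_gt0 Lp_gt0 Lp_lim Lm_gt0 Lm_lim Lp_fin Lm_fin phiI.
have [D [D0 muD]] :=
  equilibrium_lower K_gt0 Lp_gt0 Lp_lim Lm_gt0 Lm_lim Lp_fin Lm_fin phiI.
have [l0 [l00 s2]] :=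
  equilibrium_exp_moment K_gt0 Lp_gt0 Lp_lim Lm_gt0 Lm_lim Lp_fin Lm_fin phiI.
have db := equilibrium_detailed_balance K_gt0 Lp_gt0 Lm_gt0 Lp_fin Lm_fin phiI g_gt0 gb.
rewrite -/mu in muD s2 db *.
set S2 := tsum (fun k => mu k * (weight k ^+ 2 * expR (l0 * weight k))).
have S20 : 0 <= S2.
  apply: tsum_ge0 => // k; apply: mulr_ge0; first exact: ltW (mu_gt0 k).
  by rewrite mulr_ge0 ?sqr_ge0 ?expR_ge0.
(* The first bound keeps the exponential moment finite, the second makes lam * S2 at most eps /
   4. *)
pose lam := Num.min l0 (eps / (4 * (S2 + 1))).
have S21 : 0 < 4 * (S2 + 1) by rewrite mulr_gt0// ltr_wpDl.
have lam0 : 0 < lam by rewrite lt_min l00 divr_gt0.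
have laml0 : lam <= l0 by rewrite ge_min lexx.
have lamS : lam * S2 <= eps / 4.
  apply: (@le_trans _ _ (eps / (4 * (S2 + 1)) * S2)).
    by apply: ler_wpM2r => //; rewrite ge_min lexx orbT.
  have -> : eps / 4 = eps / (4 * (S2 + 1)) * (S2 + 1).
    by field; rewrite gt_eqF// ltr_wpDl.
  by rewrite ler_wpM2l ?lerDl// divr_ge0// ltW.
have D1 : 0 < D + 1 by rewrite ltr_wpDl.
(* Then the initial entropy is at most lam * eps / 4, and the norm at time t at most eps / 4 + lam *
   S2 <= eps / 2. *)
exists (lam * eps / 4 / (D + 1)); split; first by rewrite !divr_gt0// mulr_gt0.
move=> f0 [lf0 f00 f01] near f [ff0 [df [fC1 dfE]]] t t0.
have lf (s : R) : 0 <= s -> l11 (f s) by case: fC1 => H _ _ _; exact: H.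
have f0ge k : 0 <= f 0 k by rewrite ff0.
have f0m : tsum (f 0) = 1 by rewrite ff0.
have ent0 : entropy_le mu (f 0) (lam * eps / 4).
  have e0 := entropy_le_norm mu_gt0 mu_sum mu_mass mu_l11 muD D0 (lf 0 (lexx 0)) f0ge f0m.
  move=> a ba; apply: (le_trans (e0 a ba)); rewrite lerD2r.
  move: near; rewrite -/mu -ff0 norm11_fine ?lte_fin; last exact: l11B (lf 0 (lexx 0)) mu_l11.
  by rewrite ltr_pdivlMr// => /ltW; rewrite mulrC.
(* Only finiteness of the entropy on [0, t] matters here; its value does not enter the final
   bound. *)
have entb : exists M, forall s : R, s \in `[0, t] -> entropy_le mu (f s) M.
  have [P [P0 fP]] := rnorm11_bounded_along fC1 t.
  exists ((D + 1) * (P + rnorm11 mu)) => s sT.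
  have s0 : 0 <= s by move: sT; rewrite in_itv/= => /andP[].
  have fs1 : tsum (f s) = 1 by rewrite (mass_conservation K_gt0 K_le fC1 dfE).
  have e1 := entropy_le_norm mu_gt0 mu_sum mu_mass mu_l11 muD D0 (lf s s0)
    (nonneg_preserved K_gt0 K_le fC1 dfE f0ge s0) fs1.
  move=> a ba; apply: (le_trans (e1 a ba)); rewrite lerD2r ler_pM2l//.
  have := rnorm11D (lf s s0) (l11Z (-1) mu_l11).
  rewrite rnorm11Z// normrN1 mul1r scaleN1r => /le_trans; apply.
  by rewrite lerD2r; exact: fP.
have entt := entropy_le_decay mu_gt0 mu_sum mu_mass K_gt0 K_le db fC1 dfE f0ge f0m
  t0 ent0 entb.
apply: le_lt_trans (norm_le_entropy mu_gt0 mu_sum mu_mass mu_l11 lam0 laml0 s2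
  (lf t t0) entt) _.
rewrite lte_fin -/S2 -mulrA (mulrC lam) mulfK ?gt_eqF//.
by apply: (@le_lt_trans _ _ (eps / 4 + eps / 4)); [rewrite lerD2l|lra].
Qed.
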